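(* Let $k$ be a field of characteristic zero and let $A = k[x,y]$ be the polynomial algebra in two commuting variables over $k$. The following two statements are equivalent: (1) For every $k$-derivation $D$ of $A$ such that $\operatorname{div} D = 0$ and $1 \in \operatorname{Im} D$, the image $\operatorname{Im} D := D(A)$ is a Mathieu subspace of $A$. (2) The two-dimensional Jacobian conjecture (over $k$) is true.
   Context: Every $k$-derivation $D$ of $A = k[x,y]$ can be written uniquely as $D = p\,\partial_x + q\,\partial_y$ with $p, q \in A$; its divergence is $\operatorname{div} D := \partial_x p + \partial_y q$. Let $R$ be a commutative $k$-algebra (with unit). A $k$-subspace $M$ of $R$ is called a Mathieu subspace of $R$ if the following holds: whenever $a \in R$ satisfies $a^m \in M$ for all $m \ge 1$, then for every $b \in R$ there exists $N \in \mathbb{N}$ such that $b a^m \in M$ for all $m \ge N$. The two-dimensional Jacobian conjecture over $k$ is the assertion: for all $f, g \in k[x,y]$ such that the Jacobian determinant $\partial_x f\,\partial_y g - \partial_y f\,\partial_x g$ is a nonzero constant in $k$, the polynomial map $F = (f,g)$ is invertible over $k$, i.e. $k[f,g] = k[x,y]$. *)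

(* Defs.v *)
From HB Require Import structures.
From mathcomp Require Import all_boot all_order all_algebra ring.
From mathcomp Require Export mpoly.

Set Implicit Arguments.
Unset Strict Implicit.
Unset Printing Implicit Defensive.

Import GRing.Theory.
Local Open Scope ring_scope.

Section Algebra.
Variables (k : fieldType) (R : comAlgType k).

Definition is_derivation (D : {linear R -> R}) : Prop :=
  forall a b : R, D (a * b) = D a * b + a * D b.

Definition im_of (D : R -> R) : R -> Prop := fun b => exists a : R, D a = b.

Definition is_subspace (M : R -> Prop) : Prop :=
  [/\ M 0,
      forall a b : R, M a -> M b -> M (a + b)
    & forall (c : k) (a : R), M a -> M (c *: a)].

Definition is_mathieu_subspace (M : R -> Prop) : Prop :=
  is_subspace M /\
  forall a : R, (forall m : nat, (1 <= m)%N -> M (a ^+ m)) ->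
  forall b : R, exists N : nat,
  forall m : nat, (N <= m)%N -> M (b * a ^+ m).

End Algebra.

Section Plane.
Variable k : fieldType.

(* k[x, y] is {mpoly k[2]}; x and y are its variables of index 0 and 1. *)
Definition vx : {mpoly k[2]} := 'X_(0 : 'I_2).
Definition vy : {mpoly k[2]} := 'X_(1 : 'I_2).
Definition dx (p : {mpoly k[2]}) : {mpoly k[2]} := p^`M((0 : 'I_2)).
Definition dy (p : {mpoly k[2]}) : {mpoly k[2]} := p^`M((1 : 'I_2)).

(* The coefficients of D = p d/dx + q d/dy are p = D x and q = D y: see
   derivation_coefE and derivation_coef_uniq below. *)
Definition divergence (D : {linear {mpoly k[2]} -> {mpoly k[2]}}) :
  {mpoly k[2]} := dx (D vx) + dy (D vy).

Definition jacobian (f g : {mpoly k[2]}) : {mpoly k[2]} :=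
  dx f * dy g - dy f * dx g.

(* The subalgebra k[f, g]: the polynomial expressions P(f, g). *)
Definition in_generated (f g h : {mpoly k[2]}) : Prop :=
  exists P : {mpoly k[2]}, P \mPo [tuple f; g] = h.

Definition is_invertible_map (f g : {mpoly k[2]}) : Prop :=
  forall h : {mpoly k[2]}, in_generated f g h.

Definition jacobian_conjecture2 : Prop :=
  forall f g : {mpoly k[2]},
  (exists2 c : k, c != 0 & jacobian f g = c%:MP) -> is_invertible_map f g.

Let submU (i : 'I_2) : (U_(i) - U_(i))%MM = 0%MM.
Proof. by rewrite -{1}[U_(i)%MM]add0m addmK. Qed.

Lemma derivation_coefE (D : {linear {mpoly k[2]} -> {mpoly k[2]}}) :
  is_derivation D -> forall a, D a = D vx * dx a + D vy * dy a.
Proof.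
move=> dD.
have D1 : D 1 = 0.
  by apply: (addIr (D 1)); have := dD 1 1; rewrite !mulr1 mul1r add0r => <-.
pose E a := D a = D vx * dx a + D vy * dy a.
have EM a b : E a -> E b -> E (a * b).
  rewrite /E /dx /dy => Ea Eb; rewrite dD Ea Eb !mderivM.
  by ring.
have E1 : E 1 by rewrite /E /dx /dy D1 -mpolyC1 !mderivC !mulr0 addr0.
have EU (i : 'I_2) : E 'X_i.
  rewrite /E /dx /dy !mderivX !mnm1E.
  have [->|->] : i = 0 \/ i = 1.
    by case: i => [[|[|//]] ?]; [left|right]; apply: val_inj.
  - by rewrite /= scale1r scale0r mulr0 addr0 submU mpolyX0 mulr1.
  - by rewrite /= scale1r scale0r mulr0 add0r submU mpolyX0 mulr1.
move=> a; rewrite -/(E a); elim/mpolyind: a => [|c m p _ _ Ep].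
  by rewrite /E /dx /dy !linear0 !mulr0 addr0.
have Em : E 'X_[m].
  rewrite mpolyXE_id; elim/big_rec: _ => // i x _ Ex; apply: (EM) => //.
  by elim: (m i) => [|j IH]; rewrite ?expr0 // exprS; apply: (EM).
rewrite /E /dx /dy linearD linearZ /= Em Ep /dx /dy !mderivD !mderivZ.
by rewrite !mulrDr scalerDr !scalerAr addrACA.
Qed.

Lemma derivation_coef_uniq (D : {linear {mpoly k[2]} -> {mpoly k[2]}}) p q :
  (forall a, D a = p * dx a + q * dy a) -> p = D vx /\ q = D vy.
Proof.
move=> DE; rewrite !DE /dx /dy /vx /vy !mderivX !mnm1E /=.
by rewrite !scale1r !scale0r !mulr0 addr0 add0r !submU mpolyX0 !mulr1.
Qed.

End Plane.

(* Main.v *)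
From HB Require Import structures.
Require Import Defs.
From mathcomp Require Import all_boot all_order all_fingroup all_algebra.
From mathcomp Require Import generic_quotient ring zify.
From Stdlib Require Import Classical.
Import Order.TTheory GRing.Theory Num.Theory.
Set Implicit Arguments.
Unset Strict Implicit.
Unset Printing Implicit Defensive.
Local Open Scope ring_scope.
Local Notation "x %:F" := (FracField.tofrac x).
Local Notation i0 := (0 : 'I_2)%R.
Local Notation i1 := (1 : 'I_2)%R.

(** Both statements are about the derivations [D a = c^-1 * jac(f, a)], where
[jac(f, g) = c] is a nonzero constant.  Such a [D] has divergence zero and
[D g = 1]; conversely a divergence-free derivation is Hamiltonian, so if [1] is
in its image it has this form.  A Mathieu subspace containing [1] is the whole
ring.  Hence the first statement says that all these [D] are surjective.  If
[k[f, g] = k[x, y]] then [D] is the partial derivative along [g], which is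
surjective in characteristic zero.

Conversely, let [D] be surjective.  It suffices to show that [D] is locally
nilpotent: integrating along [g] then reduces an arbitrary polynomial to the
kernel of [D], which is [k[f]] ([kernel_jac_der]).  Local nilpotence holds for
every surjective derivation [D] of a domain [A] that has finite rank over
[S = R[v]] and on which [D] extends [d/dv] ([finite_rank_locally_nilpotent]);
here [R = k[f]] and [v = g], and the rank is finite by a dimension count
([free_family_bound]).  The argument plays two facts on degrees in [v] against
each other.

- The derivative of a rational function of [v] never has degree -1: it has no
  residue at infinity ([fdeg_fderiv_neqN1]).  The trace from [A] to fractions of
  [S] commutes with the derivations, and every element of [A] is a derivative,
  so no trace of an element of [A] has degree -1; multiplying by powers of [v],
  none has negative degree ([trace_no_negative_degree]).

- [D] lowers the largest order of pole of an element over [v = oo] by at least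
  a fixed positive amount ([der_le_N1]).  The traces of the products
  [D^m a * e i] with a basis [e i] therefore vanish for large [m], and the trace
  form is nondegenerate, so that [D^m a = 0].

Puiseux expansions at infinity would give the second fact, but linear algebra
suffices.  The largest order of pole is the growth rate of the degree of the
matrices of multiplication by [a ^+ k].  It bounds the coefficients of the
characteristic polynomial of [a] as the roots of that polynomial would
([power_bounded_char_poly]).  If [D] did not lower it, then, shifting degrees by
the least possible amount, [D] would induce a nonzero derivation of the
associated graded ring that is trivial on the graded ring of [S], because
[d/dv] does lower degrees.  This is impossible since the former ring is reduced
and integral over the latter ([der_le_descent]). *)

(** * Fractions of an integral domain *)
Section Fractions.
Variable S : idomainType.

Lemma fraction_numden (x : {fraction S}) :
  {pq : S * S | pq.2 != 0 & x = pq.1%:F / pq.2%:F}.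
Proof.
suff ex_pq : exists pq : S * S, (pq.2 != 0) && (x == pq.1%:F / pq.2%:F).
  by have [pq /andP[q0 /eqP ->]] := sigW ex_pq; exists pq.
elim/quotW: x => r; exists (\n_r, \d_r) => /=; rewrite denom_ratioP /=.
apply/eqP/(canRL (mulfK _)); first by rewrite tofrac_eq0 denom_ratioP.
rewrite -[LHS]/(FracField.mul _ _) !piE; apply/eqmodP.
rewrite /= FracField.equivfE /FracField.mulf /=.
by rewrite !numden_Ratio ?mulf_neq0 ?oner_neq0 ?denom_ratioP // !mulr1 mulrC.
Qed.

Definition numer (x : {fraction S}) := (s2val (fraction_numden x)).1.
Definition denom (x : {fraction S}) := (s2val (fraction_numden x)).2.

Lemma denom_neq0 x : denom x != 0.
Proof. exact: (s2valP (fraction_numden x)). Qed.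

Lemma fracE x : x = (numer x)%:F / (denom x)%:F.
Proof. exact: (s2valP' (fraction_numden x)). Qed.

Lemma tofrac_inj : injective (@FracField.tofrac S).
Proof. by move=> p q /eqP; rewrite tofrac_eq => /eqP. Qed.

Lemma fracP (p q p' q' : S) : q != 0 -> q' != 0 ->
  p%:F / q%:F = p'%:F / q'%:F -> p * q' = p' * q.
Proof.
move=> q0 q'0 /eqP; rewrite eqr_div ?tofrac_eq0 // -!tofracM => /eqP.
exact: tofrac_inj.
Qed.

Lemma numer_eq0 x : (numer x == 0) = (x == 0).
Proof.
by rewrite {2}[x]fracE mulf_eq0 invr_eq0 !tofrac_eq0 (negPf (denom_neq0 x)) orbF.
Qed.

End Fractions.

(** * Degree and derivative of rational functions *)

(** The quotient rule for sums and products, as identities between quotients: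
here [dp] stands for the derivative of [p]. *)
Fact quotient_ruleD (K : fieldType) (p q p' q' dp dq dp' dq' : K) :
  q != 0 -> q' != 0 ->
  ((dp * q' + p * dq' + (dp' * q + p' * dq)) * (q * q')
     - (p * q' + p' * q) * (dq * q' + q * dq')) / (q * q' * (q * q'))
  = (dp * q - p * dq) / (q * q) + (dp' * q' - p' * dq') / (q' * q').
Proof. by move=> q0 q'0; field; apply/andP. Qed.

Fact quotient_ruleM (K : fieldType) (p q p' q' dp dq dp' dq' : K) :
  q != 0 -> q' != 0 ->
  ((dp * p' + p * dp') * (q * q') - p * p' * (dq * q' + q * dq'))
     / (q * q' * (q * q'))
  = (dp * q - p * dq) / (q * q) * (p' / q')
    + p / q * ((dp' * q' - p' * dq') / (q' * q')).
Proof. by move=> q0 q'0; field; apply/andP. Qed.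

Section FractionDegree.
Variable R : idomainType.
Local Notation S := {poly R}.
Local Notation F := {fraction {poly R}}.
Implicit Types (x y : F) (p q : S).

Definition fderiv x : F :=
  ((numer x)^`() * denom x - numer x * (denom x)^`())%:F
    / (denom x * denom x)%:F.

Lemma fderiv_frac p q : q != 0 ->
  fderiv (p%:F / q%:F) = (p^`() * q - p * q^`())%:F / (q * q)%:F.
Proof.
move=> q0; rewrite /fderiv; set x := p%:F / q%:F.
have Q0 := denom_neq0 x; move: (fracE x); rewrite {1}/x.
move: (numer x) (denom x) Q0 => P Q Q0 /fracP => /(_ q0 Q0) E.
have E' : p^`() * Q + p * Q^`() = P^`() * q + P * q^`().
  by rewrite -!derivM E.
apply/eqP; rewrite eqr_div ?tofrac_eq0 ?mulf_neq0 //.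
rewrite -!tofracM tofrac_eq; apply/eqP.
have -> : (P^`() * Q - P * Q^`()) * (q * q)
        = q * Q * (P^`() * q + P * q^`()) - q * q^`() * Q * P - P * q * Q^`() * q.
  by ring.
rewrite -E' -E; have -> : q * q^`() * Q * P = q^`() * Q * (P * q) by ring.
by rewrite -E; ring.
Qed.

Lemma fderiv_tofrac p : fderiv p%:F = (p^`())%:F.
Proof.
rewrite -[p%:F]divr1 -tofrac1 fderiv_frac ?oner_neq0 //.
by rewrite -polyC1 derivC mulr0 subr0 polyC1 !mulr1 tofrac1 divr1.
Qed.

Lemma fderivD : {morph fderiv : x y / x + y}.
Proof.
move=> x y; rewrite [x]fracE [y]fracE.
move: (denom_neq0 x) (denom_neq0 y).
move: (numer x) (denom x) (numer y) (denom y) => p q p' q' q0 q'0.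
have [fq0 fq'0] : q%:F != 0 /\ q'%:F != 0 by rewrite !tofrac_eq0.
have -> : p%:F / q%:F + p'%:F / q'%:F = (p * q' + p' * q)%:F / (q * q')%:F.
  by rewrite (addf_div _ _ fq0 fq'0) tofracD !tofracM.
rewrite (fderiv_frac _ (mulf_neq0 q0 q'0)) (fderiv_frac _ q0) (fderiv_frac _ q'0).
rewrite !derivE.
rewrite !(tofracD, tofracM, tofracN).
rewrite (quotient_ruleD _ _ _ _ _ _ fq0 fq'0); reflexivity.
Qed.

Lemma fderivM x y : fderiv (x * y) = fderiv x * y + x * fderiv y.
Proof.
rewrite [x]fracE [y]fracE.
move: (denom_neq0 x) (denom_neq0 y).
move: (numer x) (denom x) (numer y) (denom y) => p q p' q' q0 q'0.
have [fq0 fq'0] : q%:F != 0 /\ q'%:F != 0 by rewrite !tofrac_eq0.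
have -> : p%:F / q%:F * (p'%:F / q'%:F) = (p * p')%:F / (q * q')%:F.
  by rewrite mulf_div !tofracM.
rewrite (fderiv_frac _ (mulf_neq0 q0 q'0)) (fderiv_frac _ q0) (fderiv_frac _ q'0).
rewrite !derivE.
rewrite !(tofracD, tofracM, tofracN).
rewrite (quotient_ruleM _ _ _ _ _ _ fq0 fq'0); reflexivity.
Qed.

Lemma fderiv0 : fderiv 0 = 0.
Proof. by rewrite -tofrac0 fderiv_tofrac deriv0. Qed.

Definition fdeg x : int := (size (numer x))%:Z - (size (denom x))%:Z.

Lemma fdeg_frac p q : p != 0 -> q != 0 ->
  fdeg (p%:F / q%:F) = (size p)%:Z - (size q)%:Z.
Proof.
move=> p0 q0; rewrite /fdeg; set x := p%:F / q%:F.
have Q0 := denom_neq0 x.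
have P0 : numer x != 0.
  by rewrite numer_eq0 /x mulf_neq0 ?invr_eq0 ?tofrac_eq0.
move: (fracE x); rewrite {1}/x.
move: (numer x) (denom x) P0 Q0 => P Q P0 Q0 /fracP => /(_ q0 Q0) E.
have := congr1 (fun r : S => size r) E; rewrite !size_mul //.
move: p0 q0 P0 Q0; rewrite -!size_poly_gt0. lia.
Qed.

Lemma fdeg_tofrac p : p != 0 -> fdeg p%:F = (size p)%:Z - 1.
Proof.
by move=> p0; rewrite -[p%:F]divr1 -tofrac1 fdeg_frac ?oner_neq0 // size_poly1.
Qed.

Lemma fdeg_split x : x != 0 -> exists p q,
  [/\ p != 0, q != 0, x = p%:F / q%:F & fdeg x = (size p)%:Z - (size q)%:Z].
Proof.
move=> x0; exists (numer x), (denom x); rewrite -fracE numer_eq0.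
by split=> //; apply: denom_neq0.
Qed.

Lemma fdegM x y : x != 0 -> y != 0 -> fdeg (x * y) = fdeg x + fdeg y.
Proof.
move=> /fdeg_split[p [q [p0 q0 -> ->]]] /fdeg_split[p' [q' [p'0 q'0 -> ->]]].
rewrite mulf_div -!tofracM fdeg_frac ?mulf_neq0 // !size_mul //.
move: p0 q0 p'0 q'0; rewrite -!size_poly_gt0; lia.
Qed.

Lemma fdegD x y (z : int) : x != 0 -> y != 0 -> x + y != 0 ->
  fdeg x <= z -> fdeg y <= z -> fdeg (x + y) <= z.
Proof.
move=> /fdeg_split[p [q [p0 q0 -> ->]]] /fdeg_split[p' [q' [p'0 q'0 -> ->]]].
have [fq0 fq'0] : q%:F != 0 /\ q'%:F != 0 by rewrite !tofrac_eq0.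
rewrite (addf_div _ _ fq0 fq'0) -!tofracM -tofracD => s0 dx dy.
have s1 : p * q' + p' * q != 0.
  by apply: contraNneq s0 => ->; rewrite tofrac0 mul0r.
rewrite fdeg_frac ?mulf_neq0 // size_mul //.
have := size_polyD (p * q') (p' * q); rewrite !size_mul //.
move: p0 q0 p'0 q'0 dx dy; rewrite -!size_poly_gt0.
by move: (size p) (size q) (size p') (size q') (size (_ + _ : S)); lia.
Qed.

Lemma size_wronskian p q : p != 0 -> q != 0 ->
  (size (p^`() * q - p * q^`())%R <= (size p + size q).-2)%N.
Proof.
move=> p0 q0.
have := size_polyD (p^`() * q) (- (p * q^`())); rewrite size_polyN.
have := size_polyMleq p^`() q; have := size_polyMleq p q^`().
have := lt_size_deriv p0; have := lt_size_deriv q0.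
move: p0 q0; rewrite -!size_poly_gt0.
move: (size (_ - _ : S)) (size (_ * q : S)) (size (p * _ : S)).
by move: (size p) (size q) (size p^`()) (size q^`()); lia.
Qed.

Lemma fderiv_split x : fderiv x != 0 -> exists p q,
  [/\ p != 0, q != 0, fdeg x = (size p)%:Z - (size q)%:Z,
      p^`() * q - p * q^`() != 0 &
      fdeg (fderiv x) =
        (size (p^`() * q - p * q^`()))%:Z - (size q + size q)%:Z + 1].
Proof.
move=> d0; have x0 : x != 0 by apply: contraNneq d0 => ->; rewrite fderiv0.
have [p [q [p0 q0 xE dx]]] := fdeg_split x0; exists p, q.
move: d0; rewrite xE fderiv_frac // => d0.
have s0 : p^`() * q - p * q^`() != 0.
  by apply: contraNneq d0 => ->; rewrite tofrac0 mul0r.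
split=> //; first by rewrite -xE.
rewrite fdeg_frac ?mulf_neq0 // size_mul //.
move: q0; rewrite -!size_poly_gt0.
by move: (size (_ - _ : S)) (size q); lia.
Qed.

Lemma fdeg_fderiv x : fderiv x != 0 -> fdeg (fderiv x) <= fdeg x - 1.
Proof.
case/fderiv_split=> p [q [p0 q0 -> _ ->]].
have := size_wronskian p0 q0; move: p0 q0; rewrite -!size_poly_gt0.
by move: (size (_ - _ : S)) (size p) (size q); lia.
Qed.

Lemma coef_mul_top p q m n : (size p <= m.+1)%N -> (size q <= n.+1)%N ->
  (p * q)`_(m + n) = p`_m * q`_n.
Proof.
move=> sp sq; rewrite coefM.
have lt_m : (m < (m + n).+1)%N by lia.
rewrite (bigD1 (Ordinal lt_m)) //= addKn big1 ?addr0 // => i.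
rewrite -val_eqE /= neq_ltn => /orP[lt_im|lt_mi].
  rewrite [q`__]nth_default ?mulr0 //; apply: leq_trans sq _.
  by have := ltn_ord i; lia.
by rewrite [p`__]nth_default ?mul0r //; apply: leq_trans sp _.
Qed.

Hypothesis char0 : forall n, n.+1%:R != 0 :> R.

Lemma mulrn_neq (c : R) m n : c != 0 -> m != n -> c *+ m - c *+ n != 0.
Proof.
move=> c0; wlog: m n / (m < n)%N => [IH|lt_mn _].
  rewrite neq_ltn => /orP[lt_mn|lt_nm]; first by apply: IH => //; rewrite ltn_eqF.
  by rewrite -opprB oppr_eq0 IH ?ltn_eqF.
rewrite -opprB oppr_eq0 -mulrnBr 1?ltnW // -mulr_natr mulf_neq0 //.
by rewrite -(subnSK lt_mn) char0.
Qed.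

(** At infinity, a nonzero degree is lowered by exactly one; and a fraction of
degree 0 is a constant plus a fraction of negative degree, whose derivative has
degree at most -2. So a derivative has no residue at infinity. *)
Lemma fdeg_fderiv_neqN1 x : fderiv x != 0 -> fdeg (fderiv x) != -1.
Proof.
case/fderiv_split=> p [q [p0 q0 _ s0 ->]].
have lp : lead_coef p != 0 by rewrite lead_coef_eq0.
have lq : lead_coef q != 0 by rewrite lead_coef_eq0.
have [Epq|Npq] := eqVneq (size p) (size q).
  pose r := lead_coef q *: p - lead_coef p *: q.
  have rE : lead_coef q *: (p^`() * q - p * q^`()) = r^`() * q - r * q^`().
    by rewrite /r derivB !derivZ -!mul_polyC; ring.
  have r0 : r != 0.
    apply: contraNneq s0 => r0; move/eqP: rE.
    by rewrite r0 deriv0 !mul0r subr0 -mul_polyC mulf_eq0 polyC_eq0 (negPf lq).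
  have lt_rq : (size r < size q)%N.
    rewrite ltnNge; apply/negP => le_qr.
    have sr : (size r <= size q)%N.
      rewrite /r; apply: leq_trans (size_polyD _ _) _.
      by rewrite size_polyN !size_scale // Epq maxnn.
    have : lead_coef r != 0 by rewrite lead_coef_eq0.
    have -> : lead_coef r = r`_(size q).-1.
      by rewrite /lead_coef (eqP (_ : size r == size q)) // eqn_leq sr.
    rewrite coefB !coefZ -{1}Epq -!lead_coefE mulrC subrr eqxx.
    by [].
  have := size_wronskian r0 q0; rewrite -rE size_scale //.
  move: r0; rewrite -!size_poly_gt0; move: lt_rq.
  by move: (size (p^`() * q - p * q^`())%R) (size r) (size q); lia.
have [a Ea] : exists a, size p = a.+1.
  by exists (size p).-1; rewrite prednK // size_poly_gt0.
have [b Eb] : exists b, size q = b.+1.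
  by exists (size q).-1; rewrite prednK // size_poly_gt0.
have sX (t : S) n : size t = n.+1 -> (size (t^`() * 'X)%R <= n.+1)%N.
  move=> st; have t0 : t != 0 by rewrite -size_poly_gt0 st.
  have := lt_size_deriv t0; rewrite st; apply: leq_trans.
  by rewrite (leq_trans (size_polyMleq _ _)) // size_polyX addn2.
have cX (t : S) n : size t = n.+1 -> (t^`() * 'X)`_n = lead_coef t *+ n.
  move=> st; rewrite coefMX /lead_coef st.
  by case: n st => [|n] //= _; rewrite coef_deriv.
have : ((p^`() * q - p * q^`()) * 'X)`_(a + b) != 0.
  have -> : (p^`() * q - p * q^`()) * 'X = (p^`() * 'X) * q - p * (q^`() * 'X).
    by ring.
  rewrite coefB !coef_mul_top ?Ea ?Eb ?sX //.
  rewrite !cX // -[p`_a]/(p`_a.+1.-1) -Ea -[q`_b]/(q`_b.+1.-1) -Eb.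
  rewrite -!lead_coefE mulrnAl mulrnAr; apply: mulrn_neq; first exact: mulf_neq0.
  by move: Npq; rewrite Ea Eb eqSS.
rewrite coefMX; case: ifP => [_ /eqP //|ab0].
move=> c0; have : ((a + b).-1 < size (p^`() * q - p * q^`())%R)%N.
  by rewrite ltnNge; apply: contraNN c0 => le; rewrite nth_default.
have := size_wronskian p0 q0; move: Npq; rewrite Ea Eb.
by move: ab0; move: (size (_ - _ : S)); lia.
Qed.

End FractionDegree.

(** * Matrices over a field with a degree function *)

(** The grading is an arbitrary predicate so as to cover both the degree of a
determinant in [F] and the weights of the coefficients of a characteristic
polynomial. *)
Lemma det_graded (R : comNzRingType) (P : int -> R -> Prop) :
  (forall z, P z 0) -> P 0 1 -> (forall z x, P z x -> P z (- x)) ->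
  (forall z x y, P z x -> P z y -> P z (x + y)) ->
  (forall z w x y, P z x -> P w y -> P (z + w) (x * y)) ->
  forall n (A : 'M[R]_n) (a b : 'I_n -> int),
  (forall i j, P (a i + b j) (A i j)) ->
  P (\sum_i a i + \sum_i b i) (\det A).
Proof.
move=> P0 P1 PN PD PM n A a b PA; apply: big_ind => [//||s _]; first exact: PD.
rewrite [\sum_i b i](reindex_inj (@perm_inj _ s)) -big_split /=.
suff : P (\sum_i (a i + b (s i))) (\prod_i A i (s i)).
  by case: odd_perm => Ps; rewrite ?expr1 ?mulN1r ?expr0 ?mul1r //; apply: PN.
elim/big_rec2: _ => [//|i z x _ Pz]; exact: PM.
Qed.

Section Degree.
Variables (F : fieldType) (d : F -> int).
Hypothesis dM : forall x y, x != 0 -> y != 0 -> d (x * y) = d x + d y.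
Hypothesis dD : forall x y (z : int), x != 0 -> y != 0 -> x + y != 0 ->
  d x <= z -> d y <= z -> d (x + y) <= z.
Implicit Types (x y : F) (z w : int).

Definition deg_le z x := (x == 0) || (d x <= z).

Lemma deg_le0 z : deg_le z 0. Proof. by rewrite /deg_le eqxx. Qed.

Lemma deg_leW z w x : z <= w -> deg_le z x -> deg_le w x.
Proof.
by rewrite /deg_le => zw /orP[->//|xz]; rewrite (le_trans xz zw) orbT.
Qed.

Lemma d1 : d 1 = 0.
Proof. by have := dM (oner_neq0 F) (oner_neq0 F); rewrite mulr1; move: (d _); lia. Qed.

Lemma deg_le1 : deg_le 0 1. Proof. by rewrite /deg_le d1 lexx orbT. Qed.

Lemma deg_leM z w x y : deg_le z x -> deg_le w y -> deg_le (z + w) (x * y).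
Proof.
rewrite /deg_le mulf_eq0; have [//|x0] := eqVneq x 0.
by have [//|y0] := eqVneq y 0; rewrite /= dM //; apply: lerD.
Qed.

Lemma deg_leN z x : deg_le z x -> deg_le z (- x).
Proof.
have N1 : d (-1) = 0.
  have N0 : (-1 : F) != 0 by rewrite oppr_eq0 oner_neq0.
  by have := dM N0 N0; rewrite mulrNN mulr1 d1; move: (d _); lia.
move=> xz; rewrite -mulN1r -[z]add0r; apply: deg_leM xz.
by rewrite /deg_le N1 lexx orbT.
Qed.

Lemma deg_leD z x y : deg_le z x -> deg_le z y -> deg_le z (x + y).
Proof.
rewrite /deg_le; have [->|x0] := eqVneq x 0; first by rewrite add0r.
have [->|y0 /=] := eqVneq y 0; first by rewrite addr0 (negPf x0).
by have [//|s0] := eqVneq (x + y) 0; apply: dD.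
Qed.

Lemma deg_le_sum z I (r : seq I) (P : pred I) (G : I -> F) :
  (forall i, P i -> deg_le z (G i)) -> deg_le z (\sum_(i <- r | P i) G i).
Proof.
by move=> Gz; apply: (big_ind (deg_le z)) => //;
  [apply: deg_le0 | apply: deg_leD].
Qed.

Lemma deg_leMn z x n : deg_le z x -> deg_le z (x *+ n).
Proof.
by move=> xz; elim: n => [|n IH]; rewrite ?mulr0n ?deg_le0 // mulrS deg_leD.
Qed.

Lemma deg_le_cancel z x y : x != 0 -> deg_le (d x + z) (x * y) -> deg_le z y.
Proof.
move=> x0; rewrite /deg_le mulf_eq0 (negPf x0) /=.
by case: eqVneq => //= y0; rewrite dM // lerD2l.
Qed.

Definition mxdeg_le m n z (A : 'M[F]_(m, n)) := forall i j, deg_le z (A i j).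

Lemma mxdeg_leW m n z w (A : 'M_(m, n)) : z <= w -> mxdeg_le z A -> mxdeg_le w A.
Proof. by move=> zw Az i j; apply: deg_leW (Az i j). Qed.

Lemma mxdeg_leD m n z (A B : 'M_(m, n)) :
  mxdeg_le z A -> mxdeg_le z B -> mxdeg_le z (A + B).
Proof. by move=> Az Bz i j; rewrite mxE deg_leD. Qed.

Lemma mxdeg_leN m n z (A : 'M_(m, n)) : mxdeg_le z A -> mxdeg_le z (- A).
Proof. by move=> Az i j; rewrite mxE deg_leN. Qed.

Lemma mxdeg_leMn m n z (A : 'M_(m, n)) k : mxdeg_le z A -> mxdeg_le z (A *+ k).
Proof. by move=> Az i j; rewrite mulmxnE deg_leMn. Qed.

Lemma mxdeg_le_sum m n z I (r : seq I) (P : pred I) (G : I -> 'M_(m, n)) :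
  (forall i, P i -> mxdeg_le z (G i)) -> mxdeg_le z (\sum_(i <- r | P i) G i).
Proof.
move=> Gz; apply: (big_ind (mxdeg_le z)) => // [i j|A B].
  by rewrite mxE deg_le0.
exact: mxdeg_leD.
Qed.

Lemma mxdeg_leM m n p z w (A : 'M_(m, n)) (B : 'M_(n, p)) :
  mxdeg_le z A -> mxdeg_le w B -> mxdeg_le (z + w) (A *m B).
Proof. by move=> Az Bw i j; rewrite mxE; apply: deg_le_sum => k _; apply: deg_leM. Qed.

Lemma mxdeg_leZ m n z w x (A : 'M_(m, n)) :
  deg_le z x -> mxdeg_le w A -> mxdeg_le (z + w) (x *: A).
Proof. by move=> xz Aw i j; rewrite mxE; apply: deg_leM. Qed.

Lemma mxdeg_le_ex m n (A : 'M_(m, n)) : exists C : nat, mxdeg_le C%:Z A.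
Proof.
exists (\sum_i \sum_j `|d (A i j)|)%N => i j; apply/orP; right.
rewrite (bigD1 i) //= (bigD1 j) //=; lia.
Qed.

(** ** Power-bounded matrices *)

Section PowerBounded.
Variables (n : nat) (A : 'M[F]_n.+1) (q C : int).
Hypothesis bdA : forall k : nat, mxdeg_le (q * k%:Z + C) (A ^+ k).

Let lam z (v : 'rV_n.+1) := forall k : nat, mxdeg_le (z + q * k%:Z) (v *m A ^+ k).

Let lam_mul z v : lam z v -> lam (z + q) (v *m A).
Proof.
move=> lv k; rewrite -mulmxA -[A *m _]/(A * _) -exprS.
by apply: mxdeg_leW (lv k.+1); lia.
Qed.

Definition replace_row (B : 'M[F]_n.+1) j (v : 'rV_n.+1) : 'M_n.+1 :=
  \matrix_(i, k) if i == j then v 0 k else B i k.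

Lemma det_replace_row B j v : \det (replace_row B j v) = (v *m \adj B) 0 j.
Proof.
rewrite (expand_det_row _ j) mxE; apply: eq_bigr => k _.
rewrite !mxE eqxx; congr (_ * (_ * \det _)).
by apply/matrixP=> a b; rewrite !mxE eq_sym (negPf (neq_lift _ _)).
Qed.

Lemma row_replace_row B j v i :
  row i (replace_row B j v) = if i == j then v else row i B.
Proof. by apply/rowP=> k; rewrite !mxE; case: eqP => // _; rewrite mxE. Qed.

(* The weight for which the entries of [char_poly_mx A] are homogeneous. *)
Let wpoly z (p : {poly F}) := forall j : nat, deg_le (z - q * j%:Z) p`_j.

Let char_poly_of_frame (B : 'M[F]_n.+1) (p : 'I_n.+1 -> int) : B \in unitmx ->
  (forall i j, deg_le (p i + q - p j) ((B *m A *m invmx B) i j)) ->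
  forall j : nat, deg_le (q * (n.+1%:Z - j%:Z)) (char_poly A)`_j.
Proof.
move=> uB le_p j; set A' := B *m A *m invmx B in le_p.
have -> : char_poly A = char_poly A'.
  rewrite /char_poly /char_poly_mx.
  have -> : 'X%:M - map_mx polyC A' = map_mx polyC B *m ('X%:M - map_mx polyC A)
                *m map_mx polyC (invmx B).
    rewrite mulmxBr mulmxBl -!map_mxM -/A' scalar_mxC -mulmxA -map_mxM.
    by rewrite mulmxV // map_mx1 mulmx1.
  rewrite !det_mulmx mulrAC -det_mulmx -map_mxM mulmxV // map_mx1 det1.
  by rewrite mul1r.
move: A' le_p => {uB}A' le_p.
have wD z (s t : {poly F}) : wpoly z s -> wpoly z t -> wpoly z (s + t).
  by move=> ws wt i; rewrite coefD; apply: deg_leD.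
have wN z (s : {poly F}) : wpoly z s -> wpoly z (- s).
  by move=> ws i; rewrite coefN; apply: deg_leN.
have wM z w (s t : {poly F}) : wpoly z s -> wpoly w t -> wpoly (z + w) (s * t).
  move=> ws wt i; rewrite coefM; apply: deg_le_sum => k _.
  apply: deg_leW (deg_leM (ws k) (wt (i - k)%N)).
  by rewrite -subzn ?mulrBr -1?ltnS //; lia.
have w0 z : wpoly z 0 by move=> i; rewrite coef0 deg_le0.
have wC (z w : int) x : z <= w -> deg_le z x -> wpoly w x%:P.
  move=> zw zx [|i]; rewrite coefC /= ?deg_le0 //; apply: deg_leW zx; lia.
have wX : wpoly q 'X.
  move=> i; rewrite coefX; case: eqP => [->|_]; last exact: deg_le0.
  by apply: deg_leW deg_le1; lia.
have := @det_graded _ wpoly w0 (wC _ _ _ (lexx 0) deg_le1) wN wD wM _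
          (char_poly_mx A') (fun i => p i + q) (fun j => - p j).
have -> : \sum_i (p i + q) + \sum_i (- p i) = q * n.+1%:Z.
  rewrite -big_split /= (eq_bigr (fun=> q)) => [|i _]; last by lia.
  by rewrite sumr_const card_ord; lia.
move=> /(_ _ j) ch; rewrite mulrBr; apply: ch => i k.
rewrite !mxE; apply: (wD); last exact/wN/wC/le_p.
have [->|_] := eqVneq i k; last by rewrite mulr0n.
by rewrite mulr1n; have -> : p k + q - p k = q by lia.
Qed.

(** The eigenvalues of [A] have degree at most [q].  This is visible in a frame
[B] adapted to the norm defined by the sets [lam z], that is, one in which the
entries of [A] are bounded by the levels [p] of the frame vectors.  Among all
frames with [row i B] in [lam (p i)], the defect [\sum_i p i - d (\det B)] is
nonnegative; if an entry of [A] violates its bound, Cramer's rule exchanges a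
vector of the frame for one that lowers the defect. *)
Lemma power_bounded_char_poly (j : nat) :
  deg_le (q * (n.+1%:Z - j%:Z)) (char_poly A)`_j.
Proof.
have defect_ge0 (B : 'M[F]_n.+1) (p : 'I_n.+1 -> int) :
    B \in unitmx -> (forall i, lam (p i) (row i B)) ->
    0 <= \sum_i p i - d (\det B).
  rewrite unitmxE unitfE => uB lB.
  have := @det_graded _ deg_le deg_le0 deg_le1 deg_leN deg_leD deg_leM _ B p (fun=> 0).
  rewrite sumr_const mul0rn addr0 /deg_le (negPf uB) /= subr_ge0; apply=> i k.
  by have := lB i 0%N 0 k; rewrite expr0 mulmx1 mxE mulr0.
suff descent (s : nat) (B : 'M[F]_n.+1) (p : 'I_n.+1 -> int) :
    B \in unitmx -> (forall i, lam (p i) (row i B)) ->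
    \sum_i p i - d (\det B) < s%:Z -> forall j : nat,
    deg_le (q * (n.+1%:Z - j%:Z)) (char_poly A)`_j.
  have [C1 leC1] : exists C1 : nat, C <= C1%:Z by exists `|C|%N; lia.
  apply: (descent (n.+1 * C1).+1 1 (fun=> C1)); first exact: unitmx1.
    move=> i k; rewrite -row_mul mul1mx => a b; rewrite mxE.
    by apply: deg_leW (bdA k i b); lia.
  by rewrite det1 d1 sumr_const card_ord; lia.
elim: s B p => [|s IH] B p uB lB; first by have := defect_ge0 B p uB lB; lia.
move=> le_s {}j; pose A' := B *m A *m invmx B.
have [/forallP le_p|] := boolP [forall i, forall k, deg_le (p i + q - p k) (A' i k)].
  by apply: char_poly_of_frame uB _ j => i k; apply/(forallP (le_p i)).
rewrite negb_forall => /existsP[i]; rewrite negb_forall => /existsP[k].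
rewrite /deg_le negb_or => /andP[A'0]; rewrite -ltNge => lt_p.
pose B1 := replace_row B k (row i B *m A).
have detB : \det B != 0 by rewrite -unitfE -unitmxE.
have detB1 : \det B1 = A' i k * \det B.
  rewrite det_replace_row -!row_mul mxE /A' /invmx uB -scalemxAr [in RHS]mxE.
  by rewrite mulrAC mulVf // mul1r.
apply: (IH B1 (fun l => if l == k then p i + q else p l)).
- by rewrite unitmxE unitfE detB1 mulf_neq0.
- by move=> l; rewrite row_replace_row; case: eqP => // _; apply: lam_mul.
rewrite detB1 dM // (bigD1 k) //= eqxx.
rewrite (eq_bigr p) => [|l /negPf ->] //.
move: le_s lt_p; rewrite (bigD1 k) //=.
by move: (\sum_(_ | _) _) (d (A' i k)) (d (\det B)) (p i) (p k); lia.
Qed.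
End PowerBounded.
End Degree.

(** * Local nilpotence in finite rank *)

Section FiniteRank.
Variables (S : idomainType) (F : fieldType) (tau : {rmorphism S -> F}).
Hypothesis tau_inj : injective tau.
Hypothesis tau_frac : forall x, exists p q, q != 0 /\ x = tau p / tau q.
Variables (A : idomainType) (ev : {rmorphism S -> A}) (n : nat).
Variable e : 'I_n.+1 -> A.
Hypothesis e_free : forall c : 'I_n.+1 -> S,
  \sum_i ev (c i) * e i = 0 -> forall i, c i = 0.
Hypothesis e_span : forall a, exists (c : {ffun 'I_n.+1 -> S}) s,
  s != 0 /\ ev s * a = \sum_i ev (c i) * e i.

Let tau_eq0 s : (tau s == 0) = (s == 0).
Proof. by rewrite -(inj_eq tau_inj) rmorph0. Qed.

Lemma common_denom (I : finType) (u : I -> F) :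
  exists s (c : I -> S), s != 0 /\ forall i, tau s * u i = tau (c i).
Proof.
have [pq pqE] : exists pq : I -> S * S, forall i,
    (pq i).2 != 0 /\ u i = tau (pq i).1 / tau (pq i).2.
  apply: (@fin_all_exists I (fun=> S * S)%type
    (fun i pq => pq.2 != 0 /\ u i = tau pq.1 / tau pq.2)) => i.
  have [p [q [q0 E]]] := tau_frac (u i).
  by exists (p, q).
exists (\prod_i (pq i).2), (fun i => (pq i).1 * \prod_(j | j != i) (pq j).2).
split=> [|i]; first by apply/prodf_neq0 => i _; case: (pqE i).
have [q0 ->] := pqE i; rewrite (bigD1 i) //= !rmorphM /=.
by rewrite mulrC mulrA divfK ?tau_eq0.
Qed.

Fact coord_key (a : A) : {cs : {ffun 'I_n.+1 -> S} * S |
  (cs.2 != 0) && (ev cs.2 * a == \sum_i ev (cs.1 i) * e i)}.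
Proof.
by apply: sigW; have [c [s [s0 E]]] := e_span a; exists (c, s); rewrite s0 E /=.
Qed.

Definition coord (a : A) : 'rV[F]_n.+1 :=
  let: exist cs _ := coord_key a in \row_i (tau (cs.1 i) / tau cs.2).

Lemma coordE a (c : 'I_n.+1 -> S) s : s != 0 ->
  ev s * a = \sum_i ev (c i) * e i -> coord a = \row_i (tau (c i) / tau s).
Proof.
rewrite /coord; case: coord_key => -[c' s'] /= /andP[s'0 /eqP E'] s0 E.
apply/rowP=> i; rewrite !mxE; apply/eqP; rewrite eqr_div ?tau_eq0 //.
rewrite -!rmorphM; apply/eqP; congr (tau _); apply/eqP; rewrite -subr_eq0; apply/eqP.
apply: (e_free (c := fun i => c' i * s - c i * s')) i.
rewrite (eq_bigr (fun i => ev s * (ev (c' i) * e i) - ev s' * (ev (c i) * e i))).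
  by rewrite sumrB -!mulr_sumr -E -E' mulrCA subrr.
by move=> i _; rewrite rmorphB !rmorphM; ring.
Qed.

Lemma coord_comb a (u : 'rV[F]_n.+1) : coord a = u ->
  exists (c : 'I_n.+1 -> S) s, [/\ s != 0, ev s * a = \sum_i ev (c i) * e i
    & forall i, tau s * u 0 i = tau (c i)].
Proof.
rewrite /coord; case: coord_key => -[c s] /= /andP[s0 /eqP E] <-.
exists c, s; split=> // i; rewrite mxE mulrC divfK //.
by rewrite tau_eq0.
Qed.

Lemma coordD : {morph coord : a b / a + b}.
Proof.
move=> a b; have [c [s [s0 Ea ua]]] := coord_comb (erefl (coord a)).
have [c' [s' [s'0 Eb ub]]] := coord_comb (erefl (coord b)).
rewrite (coordE (c := fun i => s' * c i + s * c' i) (s := s * s')) ?mulf_neq0 //.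
  apply/rowP=> i; rewrite !mxE !(rmorphD, rmorphM) /= -ua -ub.
  have [t0 t'0] : tau s != 0 /\ tau s' != 0 by rewrite !tau_eq0.
  by field; apply/andP.
rewrite (eq_bigr (fun i => ev s' * (ev (c i) * e i) + ev s * (ev (c' i) * e i))).
  by rewrite big_split -!mulr_sumr -Ea -Eb rmorphM /=; ring.
by move=> i _; rewrite rmorphD !rmorphM; ring.
Qed.

Lemma coord_ev s a : coord (ev s * a) = tau s *: coord a.
Proof.
have [c [s' [s'0 Ea ua]]] := coord_comb (erefl (coord a)).
rewrite (coordE (c := fun i => s * c i) (s := s')) //.
  apply/rowP=> i; rewrite !mxE rmorphM /= -ua mulrCA mulrC mulKf ?tau_eq0 //.
by rewrite mulrCA Ea mulr_sumr; apply: eq_bigr => i _; rewrite rmorphM mulrA.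
Qed.

Lemma coord_e i : coord (e i) = delta_mx 0 i.
Proof.
rewrite (coordE (c := fun j => (j == i)%:R) (s := 1)) ?oner_neq0 //.
  by apply/rowP=> j; rewrite !mxE eqxx rmorph1 divr1 rmorph_nat.
rewrite (bigD1 i) //= eqxx big1 => [|j /negPf->]; last by rewrite rmorph0 mul0r.
by rewrite addr0.
Qed.

Lemma ev_eq0 s : (ev s == 0) = (s == 0).
Proof.
apply/eqP/eqP=> [s0|->]; last exact: rmorph0.
apply: (e_free (c := fun=> s)) ord0.
by rewrite big1 // => i _; rewrite s0 mul0r.
Qed.

Lemma coord_eq0 a : coord a = 0 -> a = 0.
Proof.
case/coord_comb=> c [s [s0 Ea ua]]; apply/eqP.
have : ev s * a == 0.
  rewrite Ea big1 // => i _; have := ua i; rewrite mxE mulr0 => /esym/eqP.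
  by rewrite tau_eq0 => /eqP ->; rewrite rmorph0 mul0r.
by rewrite mulf_eq0 ev_eq0 (negPf s0).
Qed.

Lemma coord_inj : injective coord.
Proof.
move=> a b eq_ab; apply/eqP; rewrite -subr_eq0; apply/eqP/coord_eq0.
rewrite -[- b]mulN1r -[-1](rmorphN1 ev) coordD coord_ev rmorphN1 scaleN1r eq_ab.
exact: subrr.
Qed.

Lemma coord_surj (u : 'rV[F]_n.+1) : exists b s, s != 0 /\ coord b = tau s *: u.
Proof.
have [s [c [s0 E]]] := common_denom (u 0).
exists (\sum_i ev (c i) * e i), s; split=> //.
rewrite (coordE (c := c) (s := 1)) ?oner_neq0 ?rmorph1 ?mul1r //.
by apply/rowP=> i; rewrite !mxE ?rmorph1 divr1 E.
Qed.

(** ** Multiplication matrices and the trace *)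

Definition mulmat a : 'M[F]_n.+1 := \matrix_i coord (a * e i).

Lemma row_mulmat a i : row i (mulmat a) = coord (a * e i).
Proof. by rewrite rowK. Qed.

Lemma mulmat_ev s : mulmat (ev s) = (tau s)%:M.
Proof.
apply/row_matrixP=> i; rewrite row_mulmat coord_ev coord_e.
by apply/rowP=> j; rewrite !mxE eqxx /= [j == i]eq_sym mulr_natr.
Qed.

Lemma coord0 : coord 0 = 0.
Proof. by rewrite -[0](mulr0 (ev 0)) coord_ev rmorph0 scale0r. Qed.

Lemma coordM a b : coord (a * b) = coord b *m mulmat a.
Proof.
have [c [s [s0 Eb ub]]] := coord_comb (erefl (coord b)).
have t0 : tau s != 0 by rewrite tau_eq0.
apply: (scalerI t0); rewrite -coord_ev mulrCA Eb mulr_sumr.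
rewrite (big_morph _ coordD coord0) scalemxAl mulmx_sum_row.
by apply: eq_bigr => i _; rewrite mulrCA coord_ev row_mulmat mxE ub.
Qed.

Lemma mulmatM a b : mulmat (a * b) = mulmat a *m mulmat b.
Proof.
by apply/row_matrixP=> i; rewrite row_mul !row_mulmat -coordM mulrCA mulrA.
Qed.

Lemma mulmatD : {morph mulmat : a b / a + b}.
Proof.
by move=> a b; apply/row_matrixP=> i; rewrite [RHS]linearD /= !row_mulmat mulrDl coordD.
Qed.

Lemma mulmat_evM s a : mulmat (ev s * a) = tau s *: mulmat a.
Proof. by rewrite mulmatM mulmat_ev mul_scalar_mx. Qed.

Lemma mulmat0 : mulmat 0 = 0.
Proof. by rewrite -[0](mulr0 (ev 0)) mulmat_evM rmorph0 scale0r. Qed.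

Lemma mulmat1 : mulmat 1 = 1.
Proof. by rewrite -(rmorph1 ev) mulmat_ev rmorph1. Qed.

Lemma mulmat_sum I (r : seq I) (P : pred I) (G : I -> A) :
  mulmat (\sum_(i <- r | P i) G i) = \sum_(i <- r | P i) mulmat (G i).
Proof. exact: (big_morph _ mulmatD mulmat0). Qed.

Lemma mulmatMn a k : mulmat (a *+ k) = mulmat a *+ k.
Proof.
by elim: k => [|k IH]; rewrite ?mulr0n ?mulmat0 // !mulrS mulmatD IH.
Qed.

Lemma mulmatX a k : mulmat (a ^+ k) = mulmat a ^+ k.
Proof. by elim: k => [|k IH]; rewrite ?mulmat1 // !exprS mulmatM IH. Qed.

Lemma mulmat_eq0 a : mulmat a = 0 -> a = 0.
Proof. by move=> a0; apply: coord_eq0; rewrite -[a]mulr1 coordM a0 mulmx0. Qed.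

Definition trace a := \tr (mulmat a).

Lemma traceD : {morph trace : a b / a + b}.
Proof. by move=> a b; rewrite /trace mulmatD raddfD. Qed.

Lemma trace_evM s a : trace (ev s * a) = tau s * trace a.
Proof. by rewrite /trace mulmat_evM mxtraceZ. Qed.

Lemma trace0 : trace 0 = 0.
Proof. by rewrite /trace mulmat0 raddf0. Qed.

Lemma trace_comb a (c : 'I_n.+1 -> S) (G : 'I_n.+1 -> A) :
  a = \sum_i ev (c i) * G i -> trace a = \sum_i tau (c i) * trace (G i).
Proof.
move=> ->; rewrite (big_morph _ traceD trace0).
by apply: eq_bigr => i _; rewrite trace_evM.
Qed.

Hypothesis natF_neq0 : forall m, m.+1%:R != 0 :> F.

(** Every nonzero [a] divides a nonzero element of [S], whose trace is nonzero in
characteristic zero. *)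
Lemma trace_nondeg a : (forall i, trace (a * e i) = 0) -> a = 0.
Proof.
move=> tr0; apply/eqP; apply/negPn/negP => a0.
have {}tr0 b : trace (a * b) = 0.
  have [c [s [s0 Eb _]]] := coord_comb (erefl (coord b)).
  apply/eqP; have : tau s * trace (a * b) == 0.
    rewrite -trace_evM mulrCA Eb mulr_sumr.
    rewrite (trace_comb (c := c) (G := fun i => a * e i)).
      by rewrite big1 // => i _; rewrite tr0 mulr0.
    by apply: eq_bigr => i _; rewrite mulrCA.
  by rewrite mulf_eq0 tau_eq0 (negPf s0).
have u_a : mulmat a \in unitmx.
  rewrite unitmxE unitfE; apply/det0P => -[u u0 ua0].
  have [b [s [s0 Eb]]] := coord_surj u.
  have ab0 : a * b = 0.
    by apply: coord_eq0; rewrite coordM Eb -scalemxAl ua0 scaler0.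
  move/eqP: ab0; rewrite mulf_eq0 (negPf a0) /= => /eqP b0.
  move: Eb; rewrite b0 coord0 => /esym/eqP.
  by rewrite scaler_eq0 tau_eq0 (negPf s0) (negPf u0).
have [b [s [s0 Eb]]] := coord_surj (coord 1 *m invmx (mulmat a)).
have Eab : a * b = ev s.
  apply: coord_inj; rewrite coordM Eb -scalemxAl mulmxKV // -coord_ev mulr1.
  by [].
have := tr0 b; rewrite Eab /trace mulmat_ev mxtrace_scalar => /eqP.
by rewrite -mulr_natr mulf_eq0 tau_eq0 (negPf s0) (negPf (natF_neq0 n)).
Qed.

Definition gram : 'M[F]_n.+1 := \matrix_(i, j) trace (e i * e j).

Lemma coord_gram a j : (coord a *m gram) 0 j = trace (a * e j).
Proof.
have [c [s [s0 Ea ua]]] := coord_comb (erefl (coord a)).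
have t0 : tau s != 0 by rewrite tau_eq0.
apply: (mulfI t0); rewrite -trace_evM mulrA Ea mulr_suml.
rewrite (trace_comb (c := c) (G := fun i => e i * e j)).
  by rewrite mxE mulr_sumr; apply: eq_bigr => i _; rewrite mxE mulrA ua.
by apply: eq_bigr => i _; rewrite mulrA.
Qed.

Lemma gram_unit : gram \in unitmx.
Proof.
rewrite unitmxE unitfE; apply/det0P => -[u u0 ug0].
have [b [s [s0 Eb]]] := coord_surj u.
have b0 : b = 0.
  apply: trace_nondeg => j; rewrite -coord_gram Eb -scalemxAl ug0 scaler0.
  by rewrite mxE.
move: Eb; rewrite b0 coord0 => /esym/eqP.
by rewrite scaler_eq0 tau_eq0 (negPf s0) (negPf u0).
Qed.

(** ** The derivation *)

Variables (ds : {additive S -> S}) (dF : F -> F) (D : {additive A -> A}).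
Hypothesis dFD : {morph dF : x y / x + y}.
Hypothesis dFM : forall x y, dF (x * y) = dF x * y + x * dF y.
Hypothesis dF_tau : forall s, dF (tau s) = tau (ds s).
Hypothesis DM : forall a b, D (a * b) = D a * b + a * D b.
Hypothesis D_ev : forall s, D (ev s) = ev (ds s).

Let dF0 : dF 0 = 0. Proof. by rewrite -(rmorph0 tau) dF_tau raddf0 rmorph0. Qed.

Definition connection : 'M[F]_n.+1 := \matrix_i coord (D (e i)).

Lemma coord_der a : coord (D a) = map_mx dF (coord a) + coord a *m connection.
Proof.
have [c [s [s0 Ea ua]]] := coord_comb (erefl (coord a)).
have t0 : tau s != 0 by rewrite tau_eq0.
apply: (scalerI t0); rewrite -coord_ev.
have -> : ev s * D a = \sum_i (ev (ds (c i)) * e i + ev (c i) * D (e i))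
                       - ev (ds s) * a.
  have := congr1 D Ea; rewrite DM D_ev raddf_sum /= => E.
  rewrite -[LHS](addKr (ev (ds s) * a)) E addrC; congr (_ - _).
  by apply: eq_bigr => i _; rewrite DM D_ev.
rewrite -[- _]mulNr -rmorphN coordD coord_ev big_split coordD.
rewrite !(big_morph _ coordD coord0) scalerDr scalemxAl mulmx_sum_row.
rewrite (eq_bigr (fun i => tau (ds (c i)) *: delta_mx 0 i)); last first.
  by move=> i _; rewrite coord_ev coord_e.
rewrite [X in _ + X + _](eq_bigr (fun i => (tau s *: coord a) 0 i *: row i connection)).
  rewrite addrAC; congr (_ + _); apply/rowP => j; rewrite !mxE summxE.
  rewrite (bigD1 j) //= big1 => [|i /negPf nij]; last first.
    by rewrite !mxE eq_sym nij andbF mulr0.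
  rewrite addr0 !mxE !eqxx mulr1 -dF_tau -ua dFM dF_tau rmorphN mulNr.
  by rewrite addrAC subrr add0r.
by move=> i _; rewrite coord_ev mxE ua rowK.
Qed.

Lemma mulmat_der a :
  mulmat (D a) = map_mx dF (mulmat a) + mulmat a *m connection
                 - connection *m mulmat a.
Proof.
apply/row_matrixP=> i; rewrite linearB linearD /= !row_mul !row_mulmat.
have := coord_der (a * e i); rewrite DM coordD [coord (a * D _)]coordM.
rewrite -map_row row_mulmat rowK => E.
by apply: (addIr (coord (D (e i)) *m mulmat a)); rewrite E subrK.
Qed.

(** The connection contributes a commutator to the matrix of [D a]. *)
Lemma trace_der a : trace (D a) = dF (trace a).
Proof.
rewrite /trace mulmat_der linearB linearD /= mxtrace_mulC addrK.
rewrite /mxtrace (big_morph _ dFD dF0); apply: eq_bigr => i _.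
by rewrite mxE.
Qed.

(** ** The spectral degree *)

Variable fdeg : F -> int.
Hypothesis fdegM : forall x y, x != 0 -> y != 0 -> fdeg (x * y) = fdeg x + fdeg y.
Hypothesis fdegD : forall x y (z : int), x != 0 -> y != 0 -> x + y != 0 ->
  fdeg x <= z -> fdeg y <= z -> fdeg (x + y) <= z.
Hypothesis fdeg_dF : forall x, dF x != 0 -> fdeg (dF x) <= fdeg x - 1.
Hypothesis fdeg_dF_neqN1 : forall x, dF x != 0 -> fdeg (dF x) != -1.
Hypothesis fdeg_nat : forall k, fdeg k.+1%:R = 0.
Variable v : S.
Hypothesis v_neq0 : v != 0.
Hypothesis fdeg_v : fdeg (tau v) = 1.
Hypothesis D_surj : forall b, exists a, D a = b.

(** Every element is a derivative, hence so is every trace; a trace of negative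
degree, times a power of [v], would be a derivative of degree -1. *)
Lemma trace_no_negative_degree a : trace a != 0 -> 0 <= fdeg (trace a).
Proof.
move=> t0; rewrite leNgt; apply/negP => t_lt0.
have [j Ej] : exists j : nat, fdeg (trace a) = - j.+1%:Z.
  by exists (`|fdeg (trace a)|%N.-1); lia.
have tv0 : tau v != 0 by rewrite tau_eq0.
have fdegX k : fdeg (tau v ^+ k) = k%:Z.
  elim: k => [|k IH]; last by rewrite exprS fdegM ?expf_neq0 // fdeg_v IH; lia.
  by rewrite expr0 (d1 fdegM).
have [h Dh] := D_surj (ev (v ^+ j) * a).
have tr_h : dF (trace h) = tau v ^+ j * trace a.
  by rewrite -trace_der Dh trace_evM rmorphXn.
have nz : dF (trace h) != 0 by rewrite tr_h mulf_neq0 ?expf_neq0.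
have := fdeg_dF_neqN1 nz; rewrite tr_h fdegM ?expf_neq0 // fdegX Ej.
by apply/negP; rewrite negbK; apply/eqP; lia.
Qed.

(** Degrees are scaled by [M] so that the spectral degree, which is fractional,
can be approximated by integers finely enough for the descent below. *)
Let M := n.*2.+1.
Let d x : int := M%:Z * fdeg x.

Let dM : forall x y, x != 0 -> y != 0 -> d (x * y) = d x + d y.
Proof. by move=> x y x0 y0; rewrite /d fdegM // mulrDr. Qed.

Let dD : forall x y (z : int), x != 0 -> y != 0 -> x + y != 0 ->
  d x <= z -> d y <= z -> d (x + y) <= z.
Proof.
move=> x y z x0 y0 xy0 xz yz.
have [le_xy|/ltW le_yx] := leP (fdeg x) (fdeg y).
  by apply: le_trans yz; rewrite ler_pM2l //; apply: fdegD.
by apply: le_trans xz; rewrite ler_pM2l //; apply: fdegD.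
Qed.

Local Notation dle := (deg_le d).
Local Notation mxdle := (mxdeg_le d).

Let deg_le_dF z x : dle z x -> dle (z - M%:Z) (dF x).
Proof.
rewrite /deg_le; have [-> _|x0 /=] := eqVneq x 0; first by rewrite dF0 eqxx.
have [//|dx0 /=] := eqVneq (dF x) 0; have := fdeg_dF dx0.
rewrite /d => le_dx le_z; apply: le_trans (_ : M%:Z * (fdeg x - 1) <= _).
  by rewrite ler_pM2l.
by rewrite mulrBr mulr1 lerB.
Qed.

(** Unlike the degree of [mulmat a], the growth rate of the degree of
[mulmat (a ^+ k)] is homogeneous under powers ([sdeg_le_root]).  Geometrically it
is the largest order of pole of [a] over [v = oo]. *)
Definition sdeg_le (q : int) a := exists C : int, forall k : nat,
  mxdle (q * k%:Z + C) (mulmat (a ^+ k)).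

Lemma sdeg_leW q r a : q <= r -> sdeg_le q a -> sdeg_le r a.
Proof.
move=> le_qr [C bd]; exists C => k; apply: mxdeg_leW (bd k).
by rewrite lerD2r ler_wpM2r.
Qed.

Lemma sdeg_leM q r a b : sdeg_le q a -> sdeg_le r b -> sdeg_le (q + r) (a * b).
Proof.
move=> [C bdC] [C' bdC']; exists (C + C') => k; rewrite exprMn mulmatM.
by apply: mxdeg_leW (mxdeg_leM dM dD (bdC k) (bdC' k)); lia.
Qed.

Lemma sdeg_leD q a b : sdeg_le q a -> sdeg_le q b -> sdeg_le q (a + b).
Proof.
move=> [C bdC] [C' bdC']; exists (C + C') => k; rewrite exprDn mulmat_sum.
apply: (mxdeg_le_sum dD) => i _; rewrite mulmatMn mulmatM; apply: (mxdeg_leMn dD).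
apply: mxdeg_leW (mxdeg_leM dM dD (bdC _) (bdC' _)).
by rewrite -subzn -1?ltnS // mulrBr; lia.
Qed.

Lemma mulmat_sdeg_le q a : mxdle q (mulmat a) -> sdeg_le q a.
Proof.
move=> qa; exists 0 => k; rewrite addr0 mulmatX; elim: k => [|k IH].
  move=> i j; rewrite expr0 mxE; case: eqP => _; last exact: deg_le0.
  by rewrite mulr0; apply: deg_le1 dM.
rewrite exprS; apply: mxdeg_leW (mxdeg_leM dM dD qa IH); lia.
Qed.

Lemma sdeg_le_ex a : exists q : nat, sdeg_le q%:Z a.
Proof. by have [q qa] := mxdeg_le_ex d (mulmat a); exists q; apply: mulmat_sdeg_le. Qed.

Lemma sdeg_le0 q : sdeg_le q 0.
Proof. by apply: mulmat_sdeg_le => i j; rewrite mulmat0 mxE deg_le0. Qed.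

Lemma sdeg_le_sum q I (r : seq I) (P : pred I) (G : I -> A) :
  (forall i, P i -> sdeg_le q (G i)) -> sdeg_le q (\sum_(i <- r | P i) G i).
Proof.
by move=> Gq; apply: (big_ind (sdeg_le q)) => //;
  [apply: sdeg_le0 | apply: sdeg_leD].
Qed.

Lemma sdeg_leX q a k : sdeg_le q a -> sdeg_le (q * k%:Z) (a ^+ k).
Proof.
move=> qa; elim: k => [|k IH].
  apply: mulmat_sdeg_le => i j; rewrite expr0 mulmat1 mulr0 mxE.
  by case: eqP => _; [apply: deg_le1 dM | apply: deg_le0].
rewrite exprS; apply: sdeg_leW (sdeg_leM qa IH); lia.
Qed.

Lemma sdeg_leMn q a k : sdeg_le q a -> sdeg_le q (a *+ k).
Proof.
by move=> qa; elim: k => [|k IH]; rewrite ?mulr0n ?mulrS;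
  [apply: sdeg_le0 | apply: sdeg_leD].
Qed.

Lemma sdeg_le_root q a m : sdeg_le (q * m.+1%:Z) (a ^+ m.+1) -> sdeg_le q a.
Proof.
move=> [C bdC].
have [B [C0 bdB]] : exists B : nat, 0 <= B%:Z /\
    forall r, (r <= m)%N -> mxdle B%:Z (mulmat (a ^+ r)).
  elim: {1}m => [|m' [B [_ IH]]].
    have [B bdB] := mxdeg_le_ex d (mulmat (a ^+ 0)).
    by exists B; split=> // r; rewrite leqn0 => /eqP ->.
  have [B' bdB'] := mxdeg_le_ex d (mulmat (a ^+ m'.+1)).
  exists (B + B')%N; split=> // r; rewrite leq_eqVlt => /orP[/eqP->|le_r].
    by apply: mxdeg_leW bdB'; lia.
  by apply: mxdeg_leW (IH r _); lia.
exists (C + B%:Z + `|q| * m.+1%:Z) => k.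
rewrite {2}(divn_eq k m.+1) mulnC exprD exprM mulmatM.
apply: mxdeg_leW (mxdeg_leM dM dD (bdC _) (bdB _ _)); last first.
  by rewrite -ltnS ltn_mod.
have lt_r : (k %% m.+1 < m.+1)%N by rewrite ltn_mod.
rewrite {2}(divn_eq k m.+1); move: (k %/ _)%N (k %% _)%N lt_r => s r lt_r.
have : - q * r%:Z <= `|q| * m.+1%:Z by nia.
by rewrite PoszD PoszM mulrDr; lia.
Qed.

Lemma sdeg_le_evM q s a : s != 0 ->
  sdeg_le q (ev s * a) <-> sdeg_le (q - d (tau s)) a.
Proof.
move=> s0; have t0 k : tau s ^+ k != 0 by rewrite expf_neq0 ?tau_eq0.
have dX k : d (tau s ^+ k) = d (tau s) * k%:Z.
  elim: k => [|k IH]; first by rewrite expr0 (d1 dM) mulr0.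
  by rewrite exprS dM ?tau_eq0 // IH; lia.
split=> -[C bdC]; exists C => k.
  move=> i j; apply: (deg_le_cancel dM (t0 k)); rewrite dX.
  have := bdC k i j; rewrite exprMn -(rmorphXn ev) mulmat_evM mxE rmorphXn.
  by apply: deg_leW; rewrite mulrBl; lia.
rewrite exprMn -(rmorphXn ev) mulmat_evM rmorphXn.
have := mxdeg_leZ dM (_ : dle (d (tau s) * k%:Z) (tau s ^+ k)) (bdC k).
rewrite {1}/deg_le dX lexx orbT => /(_ isT); apply: mxdeg_leW.
by rewrite mulrBl; lia.
Qed.

Lemma sdeg_le_char_poly q a (j : nat) : sdeg_le q a ->
  dle (q * (n.+1%:Z - j%:Z)) (char_poly (mulmat a))`_j.
Proof.
case=> C bdC; apply: (power_bounded_char_poly dM dD (C := C)) => k.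
by rewrite -mulmatX.
Qed.

Lemma sdeg_le_trace q a : sdeg_le q a -> dle q (trace a).
Proof.
move=> /sdeg_le_char_poly-/(_ n); rewrite char_poly_trace //.
by move/(deg_leN dM); rewrite opprK; apply: deg_leW; lia.
Qed.

(** The trace form is nondegenerate, so an element is recovered from the traces
of its multiples. *)
Lemma sdeg_le_mulmat : exists C : nat, forall q a,
  sdeg_le q a -> mxdle (q + C%:Z) (mulmat a).
Proof.
have [C1 bd1] : exists C : nat, forall i j, sdeg_le C%:Z (e i * e j).
  have [C bdC] : exists C : 'I_n.+1 * 'I_n.+1 -> nat,
      forall ij, sdeg_le (C ij)%:Z (e ij.1 * e ij.2).
    apply: (@fin_all_exists _ (fun=> nat)
      (fun ij C => sdeg_le C%:Z (e ij.1 * e ij.2))) => ij.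
    exact: sdeg_le_ex.
  exists (\sum_ij C ij)%N => i j; apply: sdeg_leW (bdC (i, j)).
  by rewrite lez_nat (bigD1 (i, j)) //= leq_addr.
have [C2 bd2] := mxdeg_le_ex d (invmx gram).
exists (C1 + C2)%N => q a qa i j.
have -> : mulmat a i j = ((coord (a * e i) *m gram) *m invmx gram) 0 j.
  by rewrite mulmxK ?gram_unit // -row_mulmat [in RHS]mxE.
have : mxdle (q + C1%:Z) (coord (a * e i) *m gram).
  move=> z k; rewrite ord1 coord_gram -mulrA.
  by apply: sdeg_le_trace; apply: sdeg_leM.
by move/(mxdeg_leM dM dD)/(_ bd2)=> /(_ 0 j); rewrite PoszD addrA.
Qed.

Lemma sdeg_le_der_ex : exists kappa : nat, forall q a,
  sdeg_le q a -> sdeg_le (q + kappa%:Z) (D a).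
Proof.
have [C bdC] := sdeg_le_mulmat; have [C' bdC'] := mxdeg_le_ex d connection.
exists (C + C')%N => q a /bdC bda; apply: mulmat_sdeg_le; rewrite mulmat_der.
apply: (mxdeg_leD dD); first apply: (mxdeg_leD dD).
- by move=> i j; rewrite mxE; apply: deg_leW (deg_le_dF (bda i j)); lia.
- by apply: mxdeg_leW (mxdeg_leM dM dD bda bdC'); lia.
- by apply: (mxdeg_leN dM); apply: mxdeg_leW (mxdeg_leM dM dD bdC' bda); lia.
Qed.

(** ** The derivation lowers the spectral degree *)

Definition pev (P : {poly S}) b := (map_poly ev P).[b].

Lemma pevE P b : pev P b = \sum_(i < size P) ev P`_i * b ^+ i.
Proof.
rewrite /pev (@horner_coef_wide _ (size P)) ?size_poly //.
by apply: eq_bigr => i _; rewrite coef_map.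
Qed.

Lemma pevMXaddC P c b : pev (P * 'X + c%:P) b = pev P b * b + ev c.
Proof. by rewrite /pev rmorphD rmorphM /= map_polyX map_polyC hornerMXaddC. Qed.

Lemma pev_der P b : D (pev P b) = pev (map_poly ds P) b + pev P^`() b * D b.
Proof.
elim/poly_ind: P => [|P c IH].
  by rewrite /pev deriv0 !raddf0 !horner0 mul0r addr0 raddf0.
have -> : map_poly ds (P * 'X + c%:P) = map_poly ds P * 'X + (ds c)%:P.
  apply/polyP=> i; rewrite !(coefD, coefMX, coefC, coef_map).
  by case: i => [|i] //=; rewrite !(add0r, addr0).
have -> : (P * 'X + c%:P)^`() = P^`() * 'X + P.
  by rewrite derivD derivM derivX derivC addr0 mulr1.
rewrite !pevMXaddC raddfD /= DM IH D_ev.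
have -> : pev (P^`() * 'X + P) b = pev P^`() b * b + pev P b.
  by rewrite /pev rmorphD rmorphM /= map_polyX hornerD hornerMX.
by ring.
Qed.

Lemma mulmat_pev P b : mulmat (pev P b) = horner_mx (mulmat b) (map_poly tau P).
Proof.
elim/poly_ind: P => [|P c IH]; first by rewrite /pev !rmorph0 horner0 mulmat0.
rewrite pevMXaddC mulmatD mulmatM mulmat_ev IH !(rmorphD, rmorphM) /=.
by rewrite map_polyX map_polyC horner_mx_X horner_mx_C.
Qed.

Lemma sdeg_leN q a : sdeg_le q a -> sdeg_le q (- a).
Proof.
move=> qa; rewrite -mulN1r -[q]add0r; apply: sdeg_leM => //.
apply: mulmat_sdeg_le => i j; rewrite -(rmorphN1 ev) mulmat_ev mxE.
by apply: (deg_leMn dD); rewrite rmorphN1; apply: (deg_leN dM); apply: deg_le1 dM.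
Qed.

(** The weight is chosen so that the monomials [P`_i * b ^+ i] have degree at most
[w] as soon as [b] has degree at most [q]. *)
Definition weight_le (q w : int) (P : {poly S}) :=
  forall i : nat, dle (w - q * i%:Z) (tau P`_i).

Lemma weight_le_pev q w P b : weight_le q w P -> sdeg_le q b -> sdeg_le w (pev P b).
Proof.
move=> wP qb; rewrite pevE; apply: sdeg_le_sum => i _.
have [->|Pi0] := eqVneq P`_i 0; first by rewrite rmorph0 mul0r; apply: sdeg_le0.
apply/(sdeg_le_evM _ _ Pi0); apply: sdeg_leW (sdeg_leX i qb).
by have := wP i; rewrite /deg_le tau_eq0 (negPf Pi0) /=; lia.
Qed.

Lemma weight_le_deriv q w P : weight_le q w P -> weight_le q (w - q) P^`().
Proof.
move=> wP i; rewrite coef_deriv rmorphMn; apply: (deg_leMn dD).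
by apply: deg_leW (wP i.+1); rewrite intS mulrDr; lia.
Qed.

Lemma weight_le_map_der q w P : weight_le q w P ->
  weight_le q (w - M%:Z) (map_poly ds P).
Proof.
move=> wP i; rewrite coef_map /= -dF_tau.
by apply: deg_leW (deg_le_dF (wP i)); lia.
Qed.

Definition der_le (kappa : int) :=
  forall q a, sdeg_le q a -> sdeg_le (q + kappa) (D a).

(** This is the characteristic polynomial with its denominators cleared.  Its degree
does not depend on [b], which makes the gain of the descent below uniform. *)
Lemma sdeg_le_relation q b : sdeg_le q b -> exists s (P : {poly S}),
  [/\ s != 0, pev P b = 0, weight_le q (d (tau s) + q * n.+1%:Z) P
    & P^`(n.+1) = (s *+ n.+1`!)%:P].
Proof.
move=> qb; set p := char_poly (mulmat b).
have sp : size p = n.+2 by rewrite size_char_poly.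
have [s [c [s0 cE]]] := common_denom (fun i : 'I_n.+2 => p`_i).
pose P := \poly_(i < n.+2) c (inord i).
have PE : map_poly tau P = tau s *: p.
  apply/polyP=> i; rewrite coef_map coefZ coef_poly.
  case: ltnP => [lt_i|le_i]; last by rewrite [p`_i]nth_default ?sp // raddf0 mulr0.
  by rewrite /= -cE inordK.
have coefP i : tau P`_i = tau s * p`_i by rewrite -coef_map PE coefZ.
have t0 : tau s != 0 by rewrite tau_eq0.
exists s, P; split=> //.
- apply: mulmat_eq0; rewrite mulmat_pev PE -mul_polyC rmorphM /=.
  by rewrite Cayley_Hamilton mulr0.
- move=> i; rewrite coefP.
  have := deg_leM dM (_ : dle (d (tau s)) (tau s)) (sdeg_le_char_poly i qb).
  rewrite {1}/deg_le lexx orbT => /(_ isT); apply: deg_leW.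
  by rewrite mulrBr; lia.
have Ptop : P`_n.+1 = s.
  apply: tau_inj; rewrite coefP; have /monicP := char_poly_monic (mulmat b).
  by rewrite lead_coefE -/p sp => ->; rewrite mulr1.
apply/polyP=> i; rewrite coef_derivn coefC; case: i => [|i].
  by rewrite addn0 Ptop ffactnn.
rewrite nth_default ?mul0rn // (leq_trans (size_poly _ _)) //.
by rewrite addnS ltnS leq_addr.
Qed.

(** The descent.  On the graded ring of the spectral degree, which is reduced and
integral over the graded ring of [S], the derivation would induce a homogeneous
derivation of degree [kappa] over that ring, hence zero: differentiating an
integral relation [P] of [b] repeatedly and multiplying by [D b] leads from
[P(b) = 0] to a power of [D b] being too small. *)
Lemma der_le_descent kappa : 0 <= kappa -> der_le kappa -> der_le (kappa - 1).
Proof.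
move=> kappa_ge0 Dle q b qb.
have [s [P [s0 Pb0 wP Ptop]]] := sdeg_le_relation qb.
set w := d (tau s) + q * n.+1%:Z in wP.
have wPj j : weight_le q (w - q * j%:Z) P^`(j).
  elim: j => [|j IH]; first by rewrite mulr0 subr0.
  by rewrite derivnS => i; apply: deg_leW (weight_le_deriv IH i); lia.
set z := D b; have qz : sdeg_le (q + kappa) z by apply: Dle.
have derX k : D (z ^+ k.+1) = (z ^+ k * D z) *+ k.+1.
  elim: k => [|k IH]; first by rewrite expr1 expr0 mul1r.
  by rewrite exprS DM IH mulrnAr mulrA -exprS [D z * _]mulrC -mulrS.
(* Each differentiation costs two factors [z]: one comes from the chain rule, the
   other makes the derivative of the power of [z] a multiple of the term [W]
   already bounded. *)
pose E j := w - q * j.+1%:Z + (q + kappa) * j.*2.+1%:Z - (kappa + M%:Z).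
have claim j : sdeg_le (E j) (pev P^`(j.+1) b * z ^+ j.*2.+1).
  elim: j => [|j IH].
    have -> : pev P^`(1) b * z ^+ 1 = - pev (map_poly ds P) b.
      by apply/eqP; rewrite -addr_eq0 addrC -pev_der Pb0 raddf0.
    apply: sdeg_leN; apply: sdeg_leW (weight_le_pev (weight_le_map_der wP) qb).
    by rewrite /E; lia.
  set R := P^`(j.+1) in IH; set W := _ * _ in IH.
  have -> : pev P^`(j.+2) b * z ^+ j.+1.*2.+1 =
      z * D W - pev (map_poly ds R) b * z ^+ j.*2.+2 - (W * D z) *+ j.*2.+1.
    rewrite /W DM pev_der -/z derX -derivnS -/R doubleS !exprS.
    by rewrite -!mulrnAr; ring.
  apply: sdeg_leD; first apply: sdeg_leD.
  - by apply: sdeg_leW (sdeg_leM qz (Dle _ _ IH)); rewrite /E; lia.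
  - apply: sdeg_leN; apply: sdeg_leW (sdeg_leM
      (weight_le_pev (weight_le_map_der (wPj j.+1)) qb) (sdeg_leX j.*2.+2 qz)).
    by rewrite /E; lia.
  - apply: sdeg_leN; apply: sdeg_leMn.
    by apply: sdeg_leW (sdeg_leM IH (Dle _ _ qz)); rewrite /E; lia.
have := claim n; rewrite Ptop /pev map_polyC hornerC /=.
have [k Ek] : exists k, n.+1`! = k.+1.
  by exists (n.+1`!.-1); rewrite prednK // fact_gt0.
have s'E : tau (s *+ n.+1`!) = tau s * k.+1%:R by rewrite Ek rmorphMn mulr_natr.
have s'0 : s *+ n.+1`! != 0.
  by rewrite -tau_eq0 s'E mulf_neq0 ?tau_eq0 ?natF_neq0.
move/(sdeg_le_evM _ _ s'0); rewrite s'E dM ?tau_eq0 ?natF_neq0 //.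
rewrite {2}/d fdeg_nat mulr0 addr0 => zM.
(* The exponent of [z] is now [M], and the gap [kappa + M] is at least [M]. *)
rewrite addrA; apply: (@sdeg_le_root _ _ n.*2); apply: sdeg_leW zM.
by rewrite /E /w /M; lia.
Qed.

Lemma der_le_N1 : der_le (-1).
Proof.
have [kappa Dle] := sdeg_le_der_ex.
elim: kappa Dle => [|kappa IH] Dle; last apply: IH.
  by have := der_le_descent (lexx 0) Dle; rewrite sub0r.
by have := der_le_descent (le0z_nat _) Dle; rewrite -addn1 PoszD addrK.
Qed.

Theorem finite_rank_locally_nilpotent a : exists m, iter m D a = 0.
Proof.
have [q qa] := sdeg_le_ex a.
have qDa m : sdeg_le (q%:Z - m%:Z) (iter m D a).
  elim: m => [|m IH]; first by rewrite subr0.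
  by rewrite iterS; apply: sdeg_leW (der_le_N1 IH); lia.
have [C bdC] : exists C : nat, forall i, sdeg_le C%:Z (e i).
  have [C bdC] : exists C : 'I_n.+1 -> nat, forall i, sdeg_le (C i)%:Z (e i).
    apply: (@fin_all_exists _ (fun=> nat) (fun i C => sdeg_le C%:Z (e i))) => i.
    exact: sdeg_le_ex.
  exists (\sum_i C i)%N => i; apply: sdeg_leW (bdC i).
  by rewrite lez_nat (bigD1 i) //= leq_addr.
exists (q + C).+1; apply: trace_nondeg => i.
have := sdeg_le_trace (sdeg_leM (qDa (q + C).+1) (bdC i)).
rewrite /deg_le; have [//|t0 /=] := eqVneq (trace _) 0.
have := trace_no_negative_degree t0; rewrite /d /M => ge0 le_d; exfalso.
by move: (fdeg _) ge0 le_d => t; nia.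
Qed.

End FiniteRank.

(** * Derivations and polynomial evaluation *)

Section Antiderivative.
Variable R : nzRingType.

Lemma ex_antiderivative (p : {poly R}) :
  (forall m (x : R), exists y, y *+ m.+1 = x) -> exists P, P^`() = p.
Proof.
move=> divR.
have [y yE] : exists y : 'I_(size p) -> R, forall i, y i *+ i.+1 = p`_i.
  apply: (@fin_all_exists 'I_(size p) (fun=> R : Type)
    (fun i (y : R) => y *+ i.+1 = p`_i)) => i.
  exact: divR.
exists (\sum_(i < size p) (y i)%:P * 'X^(i.+1)).
rewrite -[RHS]coefK poly_def raddf_sum /=; apply: eq_bigr => i _.
by rewrite mul_polyC derivZ derivXn /= -yE -scalerMnl scalerMnr.
Qed.

End Antiderivative.

Lemma deriv_eq0 (R : idomainType) (p : {poly R}) :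
  (forall m, m.+1%:R != 0 :> R) -> p^`() = 0 -> p = (p`_0)%:P.
Proof.
move=> char0 dp0; apply/polyP=> -[|i]; rewrite coefC //=.
have /eqP := congr1 (fun q : {poly R} => q`_i) dp0.
by rewrite coef_deriv coef0 -mulr_natr mulf_eq0 (negPf (char0 i)) orbF => /eqP.
Qed.

(** [D] maps an algebraic relation to one of smaller degree. *)
Lemma slice_transcendental (R A : idomainType) (phi : {rmorphism {poly R} -> A})
    (D : A -> A) :
  (forall m, m.+1%:R != 0 :> R) -> D 0 = 0 ->
  (forall p, D (phi p) = phi p^`()) ->
  (forall c, phi c%:P = 0 -> c = 0) -> forall p, phi p = 0 -> p = 0.
Proof.
move=> char0 D0 Dphi phiC p; elim: (size p) {-2}p (leqnn (size p)) => {p} [|n IH] p.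
  by rewrite leqn0 size_poly_eq0 => /eqP.
move=> le_p p0; have dp0 : p^`() = 0.
  apply: IH; last by rewrite -Dphi p0.
  have [->|nz_p] := eqVneq p 0; first by rewrite deriv0 size_poly0.
  by rewrite -ltnS (leq_trans (lt_size_deriv nz_p)).
have pC := deriv_eq0 char0 dp0.
by rewrite pC (phiC p`_0) // -pC.
Qed.

Section Plane.
Variable k : fieldType.
Hypothesis char_k : [pchar k] =i pred0.
Local Notation A := {mpoly k[2]}.
Local Notation S := {poly {poly k}}.
Implicit Types (a b f g h : A).

Lemma natk_neq0 m : m.+1%:R != 0 :> k.
Proof. by have [char0 _] := pcharf0P k; rewrite char0. Qed.

Lemma natpoly_neq0 m : m.+1%:R != 0 :> {poly k}.
Proof. by rewrite -polyC_natr polyC_eq0 natk_neq0. Qed.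

Lemma ord2P (i : 'I_2) : i = 0 \/ i = 1.
Proof. by case: i => [[|[|//]] ?]; [left|right]; apply: val_inj. Qed.

Lemma mnm2E (m : 'X_{1..2}) : m = (U_(i0) *+ m i0 + U_(i1) *+ m i1)%MM.
Proof.
apply/mnmP=> i; rewrite mnmDE !mulmnE !mnm1E.
by have [->|->] := ord2P i; rewrite eqxx /=; lia.
Qed.

Definition eval1 f : {poly k} -> A := horner_alg f.
HB.instance Definition _ f := GRing.LRMorphism.on (eval1 f).

Definition eval2 f g : S -> A := horner_eval g \o map_poly (eval1 f).
HB.instance Definition _ f g := GRing.RMorphism.on (eval2 f g).

Lemma eval1C f c : eval1 f c%:P = c%:MP.
Proof. by rewrite /eval1 horner_algC -mul_mpolyC mulr1. Qed.

Lemma eval1X f : eval1 f 'X = f.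
Proof. exact: horner_algX. Qed.

Lemma eval2C f g p : eval2 f g p%:P = eval1 f p.
Proof. by rewrite /eval2 /= map_polyC /horner_eval hornerC. Qed.

Lemma eval2X f g : eval2 f g 'X = g.
Proof. by rewrite /eval2 /= map_polyX /horner_eval hornerX. Qed.

Section Derivation.
Variable D : {linear A -> A}.
Hypothesis derD : is_derivation D.

Lemma derC c : D c%:MP = 0.
Proof. by rewrite (derivation_coefE derD) /dx /dy !mderivC !mulr0 addr0. Qed.

Lemma der_eval1 f p : D (eval1 f p) = eval1 f p^`() * D f.
Proof.
elim/poly_ind: p => [|p c IH]; first by rewrite deriv0 !raddf0 mul0r.
rewrite derivD derivM derivX derivC addr0 mulr1 !raddfD /= !rmorphM /=.
by rewrite eval1C eval1X derD derC IH; ring.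
Qed.

Lemma der_eval2 f g s : D f = 0 -> D (eval2 f g s) = eval2 f g s^`() * D g.
Proof.
move=> Df0; elim/poly_ind: s => [|s p IH]; first by rewrite deriv0 !raddf0 mul0r.
rewrite derivD derivM derivX derivC addr0 mulr1 !raddfD /= !rmorphM /=.
by rewrite eval2C eval2X derD IH der_eval1 Df0; ring.
Qed.

End Derivation.

(** Elements of [k[f, g]] are written as values of iterated univariate polynomials,
which have a degree and a derivative in the variable evaluated at [g]. *)
Lemma in_generatedP f g h : in_generated f g h <-> exists s, eval2 f g s = h.
Proof.
split=> [[P <-]|[s <-]].
  elim/mpolyind: P => [|c m P _ _ [s IH]]; first by exists 0; rewrite !raddf0.
  exists (((c *: 'X^(m i0))%:P * 'X^(m i1)) + s).
  rewrite raddfD /= IH comp_mpolyD comp_mpolyZ; congr (_ + _).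
  rewrite rmorphM rmorphXn /= eval2X eval2C linearZ /= rmorphXn /= eval1X.
  rewrite comp_mpolyX big_ord_recl big_ord1 -scalerAl.
  have -> : lift ord0 ord0 = i1 by apply: val_inj.
  by rewrite !(tnth_nth 0) /= mul1r scalerAl.
elim/poly_ind: s => [|s p [P IH]]; first by exists 0; rewrite !raddf0.
have [Q QE] : in_generated f g (eval1 f p).
  elim/poly_ind: p {IH} => [|p c [P' IH]]; first by exists 0; rewrite !raddf0.
  exists (P' * 'X_i0 + c%:MP); rewrite comp_mpolyD rmorphM /= IH.
  rewrite comp_mpolyXU comp_mpolyC /= !raddfD /= rmorphM /= eval1C.
  by rewrite eval1X.
exists (P * 'X_i1 + Q); rewrite comp_mpolyD rmorphM /= IH QE.
by rewrite comp_mpolyXU raddfD /= rmorphM /= eval2C eval2X.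
Qed.

(** * Jacobian derivations *)

Definition jac_der (c : k) f a := c *: jacobian f a.

Fact jac_der_is_linear c f : linear (jac_der c f).
Proof.
move=> x a b; rewrite /jac_der /jacobian /dx /dy !mderivD !mderivZ.
by rewrite -!mul_mpolyC; ring.
Qed.
HB.instance Definition _ c f :=
  GRing.isLinear.Build k A A *:%R (jac_der c f) (jac_der_is_linear c f).

Lemma jac_der_derivation c f : is_derivation (jac_der c f).
Proof.
move=> a b /=; rewrite /jac_der /jacobian /dx /dy !mderivM -!mul_mpolyC; ring.
Qed.

Lemma jac_derxx c f : jac_der c f f = 0.
Proof. by rewrite /jac_der /jacobian mulrC subrr scaler0. Qed.

Lemma mderiv_eval1 i f p : (eval1 f p)^`M(i) = eval1 f p^`() * f^`M(i).
Proof. by apply: (der_eval1 (D := mderiv i)) => a b; apply: mderivM. Qed.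

Lemma const_of_derivs a : dx a = 0 -> dy a = 0 -> a = (a@_0)%:MP.
Proof.
move=> dxa dya; apply/mpolyP=> m; rewrite mcoeffC.
have [->|m0] := eqVneq m 0%MM; first by rewrite mulr1.
have [i mi] : exists i, m i != 0.
  apply/existsP; apply: contraNT m0; rewrite negb_exists => /forallP mi.
  by apply/eqP/mnmP=> i; rewrite mnm0E; apply/eqP; have := mi i; rewrite negbK.
have da : a^`M(i) = 0 by have [->|->] := ord2P i.
have /eqP := mcoeff_deriv i (m - U_(i))%MM a.
rewrite da mcoeff0 submK ?lep1mP // mulr0 eq_sym -mulr_natr mulf_eq0.
by rewrite (negPf (natk_neq0 _)) orbF => /eqP.
Qed.

Lemma lt_msize_mderiv i a : a^`M(i) != 0 -> (msize a^`M(i) < msize a)%N.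
Proof.
move=> da0; rewrite -mlead_deg //.
have : mlead a^`M(i) \in msupp a^`M(i) by apply: mlead_supp.
rewrite mcoeff_msupp mcoeff_deriv -mulr_natr mulf_eq0 negb_or => /andP[lead0 _].
have := msize_mdeg_lt (_ : (mlead a^`M(i) + U_(i))%MM \in msupp a).
rewrite mcoeff_msupp => /(_ lead0); rewrite mdegD mdeg1 addn1.
by apply.
Qed.

(** ** The kernel of a Jacobian derivation with a slice *)

Section Mate.
Variables (f g : A) (c : k).
Hypothesis c_neq0 : c != 0.
Hypothesis jacE : jacobian f g = c%:MP.
Let D := jac_der c^-1 f.

Lemma jac_der_mate : D g = 1.
Proof. by rewrite /D /jac_der jacE -mul_mpolyC -mpolyCM mulVf. Qed.

Let jac0 a : jac_der c^-1 f a = 0 -> jacobian f a = 0.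
Proof.
move/eqP; rewrite /jac_der -mul_mpolyC mulf_eq0 mpolyC_eq0 invr_eq0 (negPf c_neq0).
by move/eqP.
Qed.

(** A kernel element satisfies [d a = b * d f] with [b] in the kernel again, of
smaller degree; so it is found by integrating along [f]. *)
Lemma kernel_jac_der a : D a = 0 -> exists p, eval1 f p = a.
Proof.
elim: (msize a) {-2}a (leqnn (msize a)) => {a} [|n IH] a.
  rewrite leqn0 msize_poly_eq0 => /eqP -> _; exists 0; exact: raddf0.
move=> le_a /jac0 ja.
pose b := c^-1 *: jacobian a g.
have cK : c%:MP * c^-1%:MP = 1 :> A by rewrite -mpolyCM mulfV.
have E1 : dx a = b * dx f.
  rewrite /b -mul_mpolyC -[LHS]mul1r -cK -jacE.
  move: ja; rewrite /jacobian => /eqP; rewrite subr_eq0 => /eqP ja.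
  have -> : (dx f * dy g - dy f * dx g) * c^-1%:MP * dx a =
    c^-1%:MP * (dx a * dy g * dx f - dx a * dy f * dx g) by ring.
  by rewrite [dx a * dy f]mulrC -ja; ring.
have E2 : dy a = b * dy f.
  rewrite /b -mul_mpolyC -[LHS]mul1r -cK -jacE.
  move: ja; rewrite /jacobian => /eqP; rewrite subr_eq0 => /eqP ja.
  have -> : (dx f * dy g - dy f * dx g) * c^-1%:MP * dy a =
    c^-1%:MP * (dx f * dy a * dy g - dy a * dy f * dx g) by ring.
  by rewrite ja; ring.
have jb : jacobian f b = 0.
  have := mderiv_comm i0 i1 a; rewrite -/(dx a) -/(dy a) E1 E2 !mderivM.
  rewrite [(dy f)^`M(_)]mderiv_comm => /eqP.
  rewrite -/(dx b) -/(dy b) -/(dy f) -/(dx f).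
  rewrite -subr_eq0 /jacobian => /eqP E; rewrite -[RHS]E.
  rewrite /dx /dy; ring.
have primitive (i : 'I_2) : a^`M(i) != 0 -> a^`M(i) = b * f^`M(i) ->
    exists p, eval1 f p = a.
  move=> da0 Ea; have : b * f^`M(i) != 0 by rewrite -Ea.
  rewrite mulf_eq0 negb_or => /andP[b0 df0].
  have lt_b : (msize b < msize a)%N.
    apply: leq_ltn_trans (lt_msize_mderiv da0); rewrite Ea msizeM //.
    move: df0 b0; rewrite -!msize_poly_eq0.
    by move: (msize b) (msize _); lia.
  have [p bE] : exists p, eval1 f p = b.
    apply: IH; first by rewrite -ltnS (leq_trans lt_b).
    by rewrite /D /= /jac_der jb scaler0.
  have [P PE] : exists P, P^`() = p.
    apply: ex_antiderivative => m x; exists (x / m.+1%:R).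
    by rewrite -[_ *+ _]mulr_natr divfK ?natk_neq0.
  exists (P + ((a - eval1 f P)@_0)%:P); rewrite raddfD /= eval1C.
  rewrite -const_of_derivs; first by rewrite addrC subrK.
  - by rewrite /dx mderivB mderiv_eval1 PE bE -/(dx a) E1 subrr.
  - by rewrite /dy mderivB mderiv_eval1 PE bE -/(dy a) E2 subrr.
have [dxa|Ndxa] := eqVneq (dx a) 0; first have [dya|Ndya] := eqVneq (dy a) 0.
- by exists (a@_0)%:P; rewrite eval1C -const_of_derivs.
- by apply: (primitive i1) => //; rewrite -/(dy f) -/(dy a).
- by apply: (primitive i0).
Qed.
Lemma der_eval2_mate s : D (eval2 f g s) = eval2 f g s^`().
Proof.
rewrite /D (der_eval2 (jac_der_derivation c^-1 f) _ _ (jac_derxx c^-1 f)).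
by rewrite -[X in _ * X]/(D g) jac_der_mate mulr1.
Qed.

Lemma eval2_antiderivative s : exists t, D (eval2 f g t) = eval2 f g s.
Proof.
have [t tE] : exists t, t^`() = s.
  apply: ex_antiderivative => m x; exists (m.+1%:R^-1 *: x).
  by rewrite scalerMnl -[_^-1 *+ _]mulr_natr mulVf ?natk_neq0 // scale1r.
by exists t; rewrite der_eval2_mate tE.
Qed.

Lemma locally_nilpotent_generated a m : iter m D a = 0 -> exists s, eval2 f g s = a.
Proof.
elim: m a => [|m IH] a; first by move=> /= ->; exists 0; apply: raddf0.
rewrite iterSr => /IH[s sE]; have [t tE] := eval2_antiderivative s.
have [p pE] : exists p, eval1 f p = a - eval2 f g t.
  by apply: kernel_jac_der; rewrite /D raddfB /= -/D tE sE subrr.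
by exists (t + p%:P); rewrite raddfD /= eval2C pE addrC subrK.
Qed.

Lemma eval1_inj p : eval1 f p = 0 -> p = 0.
Proof.
apply: (slice_transcendental (D := fun a => - jac_der c^-1 g a)).
- exact: natk_neq0.
- by rewrite raddf0 oppr0.
- move=> q; rewrite (der_eval1 (D := jac_der c^-1 g)); last exact: jac_der_derivation.
  have E : jac_der c^-1 g f = - D g.
    by rewrite /D /jac_der /jacobian -scalerN; congr (_ *: _); ring.
  by rewrite -[X in _ * X]/(jac_der c^-1 g f) E jac_der_mate mulrN1 opprK.
by move=> x /eqP; rewrite /= eval1C mpolyC_eq0 => /eqP.
Qed.

Lemma eval2_inj s : eval2 f g s = 0 -> s = 0.
Proof.
apply: (slice_transcendental (D := D)); [exact: natpoly_neq0 | exact: raddf0 | |].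
  exact: der_eval2_mate.
by move=> p /=; rewrite eval2C => /eval1_inj.
Qed.

End Mate.

End Plane.

(** * The rank of [k[x, y]] over [k[f, g]] *)

Lemma linear_dependence (k : fieldType) (I J : finType) (M : I -> J -> k) :
  (#|J| < #|I|)%N -> exists2 c : I -> k, (exists i, c i != 0) &
  forall j, \sum_i c i * M i j = 0.
Proof.
move=> lt_JI; pose B := \matrix_(r < #|I|, s < #|J|) M (enum_val r) (enum_val s).
have : kermx B != 0.
  rewrite kermx_eq0 /row_free neq_ltn (leq_ltn_trans (rank_leq_col _)) //.
case/rowV0Pn=> u /sub_kermxP uB u0; exists (fun i => u 0 (enum_rank i)).
  case/rV0Pn: u0 => r ur; exists (enum_val r); by rewrite enum_valK.
move=> j; have := congr1 (fun v : 'rV_#|J| => v 0 (enum_rank j)) uB.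
rewrite !mxE => E; rewrite -[RHS]E [LHS](reindex (@enum_val I predT)) /=.
  by apply: eq_bigr => r _; rewrite mxE enum_valK enum_rankK.
exact/onW_bij/enum_val_bij.
Qed.

Section Rank.
Variable k : fieldType.
Local Notation A := {mpoly k[2]}.
Local Notation S := {poly {poly k}}.
Variables f g : A.

Definition free_family n (e : 'I_n -> A) := forall c : 'I_n -> S,
  \sum_i eval2 f g (c i) * e i = 0 -> forall i, c i = 0.

(** Counting dimensions: the products [f ^+ a * g ^+ b * e l] with [a, b <= r]
are linearly independent polynomials of degree less than [(2 * d + 1) * (r + 1)]. *)
Lemma free_family_bound d n (e : 'I_n -> A) :
  (msize f <= d.+1)%N -> (msize g <= d.+1)%N -> free_family e ->
  (n <= (2 * d + 1) ^ 2)%N.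
Proof.
move=> le_f le_g fe; rewrite leqNgt; apply/negP => lt_n.
pose r := (\sum_l msize (e l))%N.
have le_e l : (msize (e l) <= r.+1)%N by rewrite /r (bigD1 l) //=; lia.
pose B := ((2 * d + 1) * r.+1)%N.
have le_mon (l : 'I_n) (a b : 'I_r.+1) : (msize (f ^+ a * g ^+ b * e l) <= B)%N.
  have leX (h : A) N : (msize h <= d.+1)%N -> (msize (h ^+ N) <= (d * N).+1)%N.
    move=> le_h; elim: N => [|N IH]; first by rewrite expr0 msize1.
    have [->|h0] := eqVneq h 0; first by rewrite exprS mul0r msize0.
    rewrite exprS msizeM ?expf_neq0 // mulnS; move: le_h IH.
    by move: (msize h) (msize (h ^+ N)); lia.
  have [->|p0] := eqVneq (f ^+ a * g ^+ b * e l) 0; first by rewrite msize0.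
  move: p0; rewrite !mulf_eq0 !negb_or => /andP[/andP[fa gb] el].
  rewrite !msizeM ?mulf_neq0 //.
  have := leX f a le_f; have := leX g b le_g; have := le_e l.
  have := ltn_ord a; have := ltn_ord b; rewrite /B.
  by move: (msize (e l)) (msize (f ^+ a)) (msize (g ^+ b)) => x y z; nia.
pose M (t : 'I_n * ('I_r.+1 * 'I_r.+1)) (m : 'I_B * 'I_B) :=
  (f ^+ t.2.1 * g ^+ t.2.2 * e t.1)@_(U_(i0) *+ m.1 + U_(i1) *+ m.2).
have card_lt : (#|{: 'I_B * 'I_B}| < #|{: 'I_n * ('I_r.+1 * 'I_r.+1)}|)%N.
  rewrite !card_prod !card_ord /B; move: lt_n; rewrite expnS expn1; nia.
have [c [t ct] cM] := linear_dependence M card_lt.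
have sum0 : \sum_t c t *: (f ^+ t.2.1 * g ^+ t.2.2 * e t.1) = 0.
  apply/mpolyP=> m; rewrite raddf_sum mcoeff0 /=.
  have [lt_m|le_m] := ltnP (mdeg m) B; last first.
    rewrite big1 // => t' _; rewrite mcoeffZ; apply/eqP; rewrite mulf_eq0 orbC.
    rewrite mcoeff_eq0 msize_mdeg_ge //.
    by rewrite (leq_trans _ le_m) ?le_mon.
  have le_mdeg i : (m i <= mdeg m)%N by rewrite mdegE (bigD1 i) //= leq_addr.
  have m0 := leq_ltn_trans (le_mdeg i0) lt_m.
  have m1 := leq_ltn_trans (le_mdeg i1) lt_m.
  rewrite -[RHS](cM (Ordinal m0, Ordinal m1)); apply: eq_bigr => t' _.
  by rewrite mcoeffZ /M /= -mnm2E.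
pose s l : S := \sum_ab (c (l, ab) *: 'X^(ab.1))%:P * 'X^(ab.2).
have s0 : forall l, s l = 0.
  have sumE : \sum_t c t *: (f ^+ t.2.1 * g ^+ t.2.2 * e t.1)
      = \sum_l \sum_ab c (l, ab) *: (f ^+ ab.1 * g ^+ ab.2 * e l).
    by rewrite pair_bigA; apply: eq_bigr => -[l ab].
  apply: fe; rewrite -[RHS]sum0 sumE; apply: eq_bigr => l _.
  rewrite /s raddf_sum mulr_suml; apply: eq_bigr => ab _ /=.
  rewrite rmorphM rmorphXn /= eval2X eval2C linearZ /= rmorphXn /= eval1X.
  by rewrite -!scalerAl mul1r.
case: t ct => l [a b]; have := congr1 (fun p : S => (p`_b)`_a) (s0 l).
rewrite /s !coef0 coef_sum coef_sum (bigD1 (a, b)) //= big1 ?addr0.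
  by rewrite coefCM coefXn eqxx mulr1 coefZ coefXn eqxx mulr1 => ->; rewrite eqxx.
move=> [a' b'] /= ne; rewrite coefCM coefXn eq_sym.
have [Eb|_] := eqVneq (b' : nat) b; last by rewrite mulr0 coef0.
rewrite mulr1 coefZ coefXn; have [Ea|_] := eqVneq (a : nat) a'; last by rewrite mulr0.
by case/eqP: ne; congr (_, _); apply: val_inj.
Qed.

Hypothesis eval2_inj0 : forall s, eval2 f g s = 0 -> s = 0.

(** A free family of maximal length, hence spanning up to denominators. *)
Lemma finite_rank : exists n (e : 'I_n.+1 -> A), free_family e /\
  forall a, exists (c : {ffun 'I_n.+1 -> S}) s,
    s != 0 /\ eval2 f g s * a = \sum_i eval2 f g (c i) * e i.
Proof.
have [B bound] : exists B, forall n (e : 'I_n -> A), free_family e -> (n <= B)%N.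
  pose d := (msize f + msize g)%N; exists ((2 * d + 1) ^ 2)%N => n e.
  by apply: free_family_bound; rewrite /d; lia.
suff grow j n (e : 'I_n.+1 -> A) : free_family e -> (B <= n + j)%N ->
    exists n (e : 'I_n.+1 -> A), free_family e /\
    forall a, exists (c : {ffun 'I_n.+1 -> S}) s,
      s != 0 /\ eval2 f g s * a = \sum_i eval2 f g (c i) * e i.
  apply: (grow B 0%N (fun=> 1)) => // c; rewrite big_ord1 mulr1 => c0 i.
  by rewrite ord1; apply: eval2_inj0.
elim: j n e => [|j IH] n e fe le_B; first by have := bound _ _ fe; lia.
apply: NNPP => nspan; case: (nspan); exists n, e; split=> // a.
apply: NNPP => na; case: nspan.
pose e' (i : 'I_n.+2) := oapp e a (insub (val i)).
apply: (IH n.+1 e'); last by lia.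
move=> c; rewrite big_ord_recr /= {2}/e' insubF ?ltnn //=.
have e'E (i : 'I_n.+1) : e' (widen_ord (leqnSn n.+1) i) = e i.
  by rewrite /e' /= valK.
rewrite (eq_bigr (fun i => eval2 f g (c (widen_ord (leqnSn n.+1) i)) * e i));
  last by move=> i _; rewrite e'E.
move=> sum0; have c_last : c ord_max = 0.
  apply/eqP; apply: contra_notT na => cl0.
  exists [ffun i => - c (widen_ord (leqnSn n.+1) i)], (c ord_max); split=> //.
  apply/eqP; rewrite -subr_eq0 -sumrN addrC -[X in _ == X]sum0; apply/eqP.
  by congr (_ + _); apply: eq_bigr => i _; rewrite ffunE raddfN mulNr opprK.
move: sum0; rewrite c_last raddf0 mul0r addr0 => sum0 i.
have [lt_i|ge_i] := ltnP i n.+1.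
  have := fe _ sum0 (Ordinal lt_i); congr (c _ = 0); exact: val_inj.
by rewrite -[RHS]c_last; congr c; apply: val_inj => /=; have := ltn_ord i; lia.
Qed.

End Rank.

(** * Proof of the equivalence *)

Section Equivalence.
Variable k : fieldType.
Hypothesis char_k : [pchar k] =i pred0.
Local Notation A := {mpoly k[2]}.
Local Notation S := {poly {poly k}}.

Lemma fraction_nat m : (m.+1%:R : {fraction S}) = (m.+1%:R : {poly k})%:P%:F.
Proof. by rewrite -(rmorph_nat (@FracField.tofrac S)) polyC_natr. Qed.

Lemma surjective_locally_nilpotent (f g : A) c :
  c != 0 -> jacobian f g = c%:MP -> (forall b, exists a, jac_der c^-1 f a = b) ->
  forall a, exists m, iter m (jac_der c^-1 f) a = 0.
Proof.
move=> c0 jac D_surj.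
have inj2 := eval2_inj char_k c0 jac.
have [n [e [e_free e_span]]] := finite_rank inj2.
have nat0 m := natpoly_neq0 char_k m.
have natF m : m.+1%:R != 0 :> {fraction S}.
  by rewrite fraction_nat tofrac_eq0 polyC_eq0.
apply: (@finite_rank_locally_nilpotent S {fraction S} (@FracField.tofrac S)
  (@tofrac_inj S) _ A (eval2 f g) n e e_free e_span natF
  (@deriv {poly k}) (@fderiv {poly k}) (jac_der c^-1 f)
  (@fderivD {poly k}) (@fderivM {poly k}) (@fderiv_tofrac {poly k})
  (jac_der_derivation c^-1 f) (der_eval2_mate c0 jac)
  (@fdeg {poly k}) (@fdegM {poly k}) (@fdegD {poly k}) (@fdeg_fderiv {poly k})
  (fdeg_fderiv_neqN1 nat0) _ 'X _ _ D_surj).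
- by move=> x; exists (numer x), (denom x); rewrite -fracE denom_neq0.
- by move=> m; rewrite fraction_nat fdeg_tofrac ?polyC_eq0 // size_polyC nat0.
- by rewrite polyX_eq0.
- by rewrite fdeg_tofrac ?polyX_eq0 // size_polyX.
Qed.

Lemma jac_der_coefE c (f a : A) :
  jac_der c f a = - (c *: dy f) * dx a + (c *: dx f) * dy a.
Proof. by rewrite /jac_der /jacobian -!mul_mpolyC; ring. Qed.

Lemma divergence_jac_der c (f : A) : divergence (jac_der c f) = 0.
Proof.
have [px py] := derivation_coef_uniq (jac_der_coefE c f).
rewrite /divergence -px -py /dx /dy mderivN !mderivZ.
by rewrite [(f^`M(_))^`M(_)]mderiv_comm addNr.
Qed.

Lemma mathieu_one (M : A -> Prop) : is_mathieu_subspace M -> M 1 -> forall b, M b.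
Proof.
case=> _ mathieuM M1 b.
have [|N MN] := mathieuM 1 _ b; first by move=> m _; rewrite expr1n.
by have := MN N (leqnn N); rewrite expr1n mulr1.
Qed.

Lemma ex_mderiv i (a : A) : exists b : A, b^`M(i) = a.
Proof.
elim/mpolyind: a => [|x m a _ _ [b bE]]; first by exists 0; apply: mderiv0.
exists ((x / (m i).+1%:R) *: 'X_[m + U_(i)] + b).
rewrite mderivD mderivZ bE mderivX addmK scalerA mnmDE mnm1E eqxx addn1.
by rewrite divfK ?natk_neq0.
Qed.

Lemma mderivU (i j : 'I_2) : ('X_i : A)^`M(j) = (i == j)%:R.
Proof.
rewrite mderivX mnm1E; have [->|_] := eqVneq i j; last by rewrite scale0r.
by rewrite scale1r -{1}[U_(j)%MM]add0m addmK mpolyX0.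
Qed.

(** Integrating [D y] along [x] gives a Hamiltonian up to a function [r] with
[dx r = 0].  By the kernel lemma for the pair [(y, x)], [r] is a polynomial in
[y], and its antiderivative is the missing term. *)
Lemma divergence0_jac (D : {linear A -> A}) : is_derivation D ->
  divergence D = 0 -> exists f, forall a, D a = jacobian f a.
Proof.
move=> derD div0.
have [F1 dxF1] := ex_mderiv i0 (D (vy k)).
have [G [dxG dyG]] : exists G : A, dx G = 0 /\ dy G = D (vx k) + dy F1.
  set r := D (vx k) + dy F1.
  have dxr : dx r = 0.
    by rewrite /dx mderivD /dy mderiv_comm dxF1 -/(dy _) -/(dx _).
  have jacyx : jacobian (vy k) (vx k) = (-1)%:MP.
    rewrite /jacobian /dx /dy !mderivU /= mul0r mulr1 sub0r.
    by rewrite raddfN.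
  have [p pE] : exists p, eval1 (vy k) p = r.
    apply: (kernel_jac_der char_k _ jacyx); first by rewrite oppr_eq0 oner_neq0.
    by rewrite /jac_der /jacobian dxr /dx mderivU /= mul0r mulr0 subr0 scaler0.
  have [P PE] : exists P, P^`() = p.
    apply: ex_antiderivative => m x; exists (x / m.+1%:R).
    by rewrite -[_ *+ _]mulr_natr divfK ?natk_neq0.
  exists (eval1 (vy k) P); rewrite /dx /dy !mderiv_eval1 PE pE !mderivU /=.
  by rewrite mulr0 mulr1.
exists (F1 - G) => a; rewrite (derivation_coefE derD) /jacobian.
have -> : dx (F1 - G) = D (vy k) by rewrite /dx mderivB -/(dx G) dxG subr0.
have -> : dy (F1 - G) = - D (vx k) by rewrite /dy mderivB -!/(dy _) dyG; ring.
by ring.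
Qed.

End Equivalence.

Theorem theorem4p3 (k : fieldType) (char_k : [pchar k] =i pred0) :
  (forall D : {linear {mpoly k[2]} -> {mpoly k[2]}},
     is_derivation D -> divergence D = 0 -> im_of D 1 ->
     is_mathieu_subspace (im_of D))
  <-> jacobian_conjecture2 k.
Proof.
split=> [mathieu_im f g [c c0 jac] h | jc D derD div0 [g Dg]].
  apply/in_generatedP.
  have D_surj : forall b, exists a, jac_der c^-1 f a = b.
    apply: (mathieu_one (M := im_of (jac_der c^-1 f))).
      apply: mathieu_im; first exact: jac_der_derivation.
        exact: divergence_jac_der.
      by exists g; apply: jac_der_mate.
    by exists g; apply: jac_der_mate.
  have [m Dm] := surjective_locally_nilpotent char_k c0 jac D_surj h.
  exact: (locally_nilpotent_generated char_k c0 jac Dm).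
have [f DE] := divergence0_jac char_k derD div0.
have jac : jacobian f g = 1%:MP by rewrite -DE Dg.
have one0 : (1 : k) != 0 by apply: oner_neq0.
have D_surj b : im_of D b.
  have /in_generatedP[s <-] := jc f g (ex_intro2 _ _ 1 one0 jac) b.
  have [t tE] := eval2_antiderivative char_k one0 jac s.
  by exists (eval2 f g t); rewrite DE -tE /jac_der invr1 scale1r.
by split=> [|a _ b]; [split=> * | exists 0%N => m _]; apply: D_surj.
Qed.
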